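(* Let $(G,H)=(\mathrm O(p,q),\mathrm O(p_1,q_1)\times\mathrm O(p-p_1,q-q_1))$ with $0<p_1<p$, $0<q_1<q$, and let $0\le r\le\min\{p,q\}$. (1) When $r<\min\{p_1,q-q_1\}+\min\{q_1,p-p_1\}$, the open $H$-orbits in $\mathrm{Gr}_G(r)$ are not unique, and they are given by $\mathcal O(0,0,0,b_U,b_W)$, where $b_U+b_W=r$, $0\le b_U\le\min\{p_1,q-q_1\}$ and $0\le b_W\le\min\{q_1,p-p_1\}$. (2) When $\min\{p_1,q-q_1\}+\min\{q_1,p-p_1\}\le r\le\min\{p,q\}$, there is a unique open $H$-orbit in $\mathrm{Gr}_G(r)$, given by $$\begin{cases}\mathcal O(r-b_U-b_W,\,0,\,0,\,b_U,\,b_W)&\text{if }\dim U>\dim W,\\ \mathcal O(0,\,r-b_U-b_W,\,0,\,b_U,\,b_W)&\text{if }\dim U\le\dim W,\end{cases}$$ where $b_U=\min\{p_1,q-q_1\}$ and $b_W=\min\{q_1,p-p_1\}$.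
   Context: $V=\mathbb R^{p+q}$ has a nondegenerate symmetric bilinear form $B$ of signature $(p,q)$; $V=U\oplus W$ with $U\perp W$, $B|_U$ of signature $(p_1,q_1)$ and $B|_W$ of signature $(p-p_1,q-q_1)$. $G$ is the isometry group of $V$ and $H$ the product of the isometry groups of $U$ and $W$. $\mathrm{Gr}_G(r)$ is the projective variety of $r$-dimensional subspaces $S$ of $V$ with $S\perp S$. For a subspace $X$, $\mathrm{Rad}(X)=X\cap X^\perp$; $\mathbf P_US=(S+W)\cap U$, $\mathbf P_WS=(S+U)\cap W$. For $S\in\mathrm{Gr}_G(r)$: $r_U(S)=\dim(S\cap U)$, $r_W(S)=\dim(S\cap W)$, $a(S)=\dim\frac{\mathrm{Rad}(\mathbf P_US)}{S\cap U}=\dim\frac{\mathrm{Rad}(\mathbf P_WS)}{S\cap W}$, and $b_U(S)$ (resp. $b_W(S)$) is the dimension of a maximal positive definite (resp. negative definite) subspace of $\mathbf P_US$. The 5-tuple $(r_U(S),r_W(S),a(S),b_U(S),b_W(S))$ determines the $H$-orbit of $S$; $\mathcal O(r_U,r_W,a,b_U,b_W)$ denotes the $H$-orbit with this 5-tuple.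
   Formalization: In (1) the claim that the open H-orbits are not unique is proved only for r > 0; for r = 0 it is false, since Gr_G(0) is the single point {0}. The description of the open orbits in (1) is kept for all r ≥ 0. *)

(* Defs.v *)
From HB Require Import structures.
From mathcomp Require Import all_boot all_order all_algebra sesquilinear.
From mathcomp Require Import all_classical all_reals all_analysis.

Set Implicit Arguments.
Unset Strict Implicit.
Unset Printing Implicit Defensive.

Import Order.TTheory GRing.Theory Num.Theory.
Import numFieldNormedType.Exports.

Local Open Scope classical_set_scope.
Local Open Scope ring_scope.

Section Forms.
Variables (R : realType) (V : vectType R) (B : {symmetric V}).
Implicit Types (U W S X P : {vspace V}) (g : 'End(V)).

Definition radical X : {vspace V} := (X :&: orthov B X)%VS.

Definition totally_isotropic S : Prop := (S <= orthov B S)%VS.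

Definition pos_definite P : Prop :=
  forall x, x \in P -> x != 0 -> 0 < B x x.

Definition neg_definite P : Prop :=
  forall x, x \in P -> x != 0 -> B x x < 0.

Definition pos_index X : nat :=
  \max_(k < (\dim X).+1 |
     `[< exists P, [/\ (P <= X)%VS, pos_definite P & \dim P = k] >]) k.

Definition neg_index X : nat :=
  \max_(k < (\dim X).+1 |
     `[< exists P, [/\ (P <= X)%VS, neg_definite P & \dim P = k] >]) k.

Definition has_signature X (a b : nat) : Prop :=
  [/\ radical X = 0%VS, pos_index X = a & neg_index X = b].

Definition isometry_of X g : Prop :=
  (g @: X)%VS = X /\ {in X &, forall x y, B (g x) (g y) = B x y}.

(* When V is the direct sum of U and W, an endomorphism satisfying both
   conditions is the same thing as a pair of isometries, one of U and one
   of W. *)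
Definition isometry_prod U W : set 'End(V) :=
  [set g | isometry_of U g /\ isometry_of W g].

Definition proj_to U W S : {vspace V} := ((S + W) :&: U)%VS.

Lemma cap_sub_radical_proj U W S :
  (U <= orthov B W)%VS -> totally_isotropic S ->
  (S :&: U <= radical (proj_to U W S))%VS.
Proof.
move=> /orthovP UW /orthovP SS; apply/subvP => x /memv_capP[xS xU].
apply/memv_capP; split; first by rewrite memv_cap xU andbT (subvP (addvSl S W)).
apply/mem_orthovP => y /memv_capP[/memv_addP[s sS [w wW ->]] _].
by rewrite linearD /= SS ?UW ?addr0.
Qed.

(* By [cap_sub_radical_proj] the difference is the dimension of the quotient
   of Rad (P_U S) by S :&: U. *)
Definition inv_a U W S : nat :=
  (\dim (radical (proj_to U W S)) - \dim (S :&: U))%N.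

Definition isoGr (r : nat) : set {vspace V} :=
  [set S | \dim S = r /\ totally_isotropic S].

Definition H_orbit U W (r : nat) (Om : set {vspace V}) : Prop :=
  exists2 S, isoGr r S & Om = [set (g @: S)%VS | g in isometry_prod U W].

Definition O_ U W (r rU rW a bU bW : nat) : set {vspace V} :=
  [set S | isoGr r S /\
     [/\ \dim (S :&: U) = rU, \dim (S :&: W) = rW, inv_a U W S = a,
         pos_index (proj_to U W S) = bU & neg_index (proj_to U W S) = bW]].

End Forms.

Section Topology.
Variables (R : realType) (n : nat).

Definition rowspan r (A : 'M[R]_(r, n)) : {vspace 'rV[R]_n} :=
  (\sum_(i < r) <[row i A]>)%VS.

(* Quotient topology on the Grassmannian of r-dimensional subspaces of R^n,
   presented as the quotient of the set of r-frames, which is itself an open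
   subset of the space of r x n matrices. *)
Definition open_in_Gr (r : nat) (Om : set {vspace 'rV[R]_n}) : Prop :=
  open [set A : 'M[R]_(r, n) | \dim (rowspan A) = r /\ Om (rowspan A)].

Definition open_in_isoGr (B : {symmetric 'rV[R]_n}) (r : nat)
    (Om : set {vspace 'rV[R]_n}) : Prop :=
  exists2 Om', open_in_Gr r Om' & Om = isoGr B r `&` Om'.

Definition open_orbit (B : {symmetric 'rV[R]_n}) (U W : {vspace 'rV[R]_n})
    (r : nat) (Om : set {vspace 'rV[R]_n}) : Prop :=
  H_orbit B U W r Om /\ open_in_isoGr B r Om.

End Topology.

(* Main.v *)
From HB Require Import structures.
Require Import Defs.
From mathcomp Require Import all_boot all_order all_algebra sesquilinear.
From mathcomp Require Import all_classical all_reals all_analysis.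
From mathcomp Require Import ring lra zify.

(* For an isotropic [S], the form [B (pi_U x) (pi_U y)] on [S] carries all the
   invariants: [b_U] and [b_W] are its positive and negative indices, and
   [S :&: U], [S :&: W] lie in its radical. Both indices are lower
   semicontinuous in [S] and bounded by [m1 = min (p1, q - q1)] and
   [m2 = min (q1, p - p1)], and their sum is at most [r]. Hence, for [k <= m1],
   [l <= m2] and [k + l = min (r, m1 + m2)], the set of those [S] with
   [b_U >= k] and [b_W >= l] is open; counting dimensions, [S :&: W = 0] or
   [S :&: U = 0], [a = 0] and both indices are exactly [k] and [l] on it, so that
   the theorems of Sylvester and Witt make it a single orbit.
   Conversely, if [b_U + b_W < min (r, m1 + m2)], say with [b_U < m1], choose
   [s <> 0] in the radical of the form on [S], a positive vector [e] of [U] and a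
   negative vector [f] of [W], both orthogonal to the projections of a maximal
   positive definite part of [S]. Arbitrarily small hyperbolic rotations in the
   plane [<e, f>] make [s] positive and increase [b_U], so the orbit of [S],
   on which [b_U] is constant, is not open. *)

(** The bound [r <= minn p q] is what makes the counting close. If [m1 + m2 < r], the mixed values
    [p1 + (p - p1) = p] and [(q - q1) + q1 = q] of [m1 + m2] are excluded, so [m1 + m2] is [\dim U]
    or [\dim W], and one of the two projections of [S] is all of [U] or all of [W]. Transitivity
    needs only [S :&: W = 0] (or [S :&: U = 0]) and a radical of the projection contained in [S].
    Then [S] is the graph of a map between its two projections that reverses the form: Sylvester
    matches the projections to one factor, the graphs transport this to the other factor, and Witt
    extends both maps. Only the growth of [b_U] is analysed. The form on the projection to [W] is
    minus the form on the projection to [U], so exchanging [U] and [W] exchanges [b_U] and [b_W].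
    The rotation gains a dimension for every parameter [c > 1], so openness serves only to pick one
    such [c] close to 1. *)

Set Implicit Arguments.
Unset Strict Implicit.
Unset Printing Implicit Defensive.

Import Order.TTheory GRing.Theory Num.Theory.
Import numFieldNormedType.Exports.

Local Open Scope classical_set_scope.
Local Open Scope ring_scope.

(** * Definite subspaces and signatures *)

Section SymmetricForms.
Variables (R : realType) (V : vectType R) (B : {symmetric V}).
Implicit Types (X Y Z P Q T : {vspace V}) (x y z : V) (eps : R).

Lemma symformC x y : B x y = B y x.
Proof. by rewrite hermC expr0 mul1r. Qed.

Lemma formDL x y z : B (x + y) z = B x z + B y z. Proof. exact: linearDl. Qed.
Lemma formDR x y z : B z (x + y) = B z x + B z y. Proof. exact: linearDr. Qed.
Lemma formNL x z : B (- x) z = - B x z. Proof. exact: linearNl. Qed.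
Lemma formNR x z : B z (- x) = - B z x. Proof. exact: linearNr. Qed.
Lemma formZL a x z : B (a *: x) z = a * B x z. Proof. exact: linearZl_LR. Qed.
Lemma formZR a x z : B z (a *: x) = a * B z x. Proof. exact: linearZr_LR. Qed.

Definition formE := (formDL, formDR, formNL, formNR, formZL, formZR).

(** Pairing with a basis of [Y] is a linear map to a space of dimension [\dim Y], and its kernel on
    [X] lies in the orthogonal of [Y]. *)
Lemma dim_cap_orthov X Y : (\dim X <= \dim (X :&: orthov B Y) + \dim Y)%N.
Proof.
pose f x : 'rV[R]_(\dim Y) := \row_i B x (vbasis Y)`_i.
have fL : linear f.
  by move=> a x y; apply/rowP => i; rewrite !mxE linearDl linearZl_LR.
pose ff := linfun (HB.pack_for {linear V -> 'rV[R]_(\dim Y)} f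
  (GRing.isLinear.Build R V 'rV[R]_(\dim Y) *:%R f fL)).
have kerE : (X :&: lker ff <= X :&: orthov B Y)%VS.
  apply/subvP => x /memv_capP[xX]; rewrite memv_ker lfunE /= => /eqP fx0.
  rewrite memv_cap xX; apply/mem_orthovP => y /coord_vbasis ->.
  rewrite linear_sumr big1 // => i _.
  by rewrite linearZr_LR /=; move/rowP: fx0 => /(_ i); rewrite !mxE => ->; rewrite mulr0.
rewrite -{1}(limg_ker_dim ff X) leq_add ?dimvS //.
by rewrite (leq_trans (dimvS (subvf _))) // dimvf /dim /= mul1n.
Qed.

(** A linear choice of preimages inside [X]. It lifts definite subspaces of a projection of [S] back
    to [S]. *)
Lemma linear_section (aT rT : vectType R) (f : 'Hom(aT, rT)) (X : {vspace aT}) :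
  exists l : 'Hom(rT, aT),
    forall y : rT, y \in (f @: X)%VS -> l y \in X /\ f (l y) = y.
Proof.
exists (projv X \o ((f \o projv X)^-1))%VF => y /memv_imgP[x xX ->].
rewrite comp_lfunE memv_proj; split => //.
rewrite -[f (projv X _)](comp_lfunE f (projv X)) limg_lfunVK //.
by rewrite -{1}(projv_id xX) -comp_lfunE memv_img // memvf.
Qed.

Lemma radicalP X x : reflect (x \in X /\ {in X, forall y, B x y = 0}) (x \in radical B X).
Proof.
apply: (iffP memv_capP) => -[xX xo]; split => //; last exact/mem_orthovP.
by move=> y yX; move/mem_orthovP: xo => /(_ y yX).
Qed.

Lemma radical0P X : reflect
  (forall x, x \in X -> {in X, forall y, B x y = 0} -> x = 0) (radical B X == 0%VS).
Proof.
apply: (iffP eqP) => [X0 x xX xo | H].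
  by apply/eqP; rewrite -memv0 -X0; apply/radicalP.
apply/eqP; rewrite -subv0; apply/subvP => x /radicalP[xX xo].
by rewrite memv0 (H x xX xo).
Qed.

Lemma capv0P X Y : reflect (forall x, x \in X -> x \in Y -> x = 0) (X :&: Y == 0)%VS.
Proof.
apply: (iffP eqP) => [XY0 x xX xY | H].
  by apply/eqP; rewrite -memv0 -XY0 memv_cap xX.
apply/eqP; rewrite -subv0; apply/subvP => x /memv_capP[xX xY].
by rewrite memv0 (H x xX xY).
Qed.

(* The sign [eps] is [1] for positive and [-1] for negative definiteness. *)
Definition sdefinite eps P := forall x, x \in P -> x != 0 -> 0 < eps * B x x.

Definition has_sdefinite eps X k :=
  exists P, [/\ (P <= X)%VS, sdefinite eps P & \dim P = k].

Lemma sdefiniteS eps P Q : (Q <= P)%VS -> sdefinite eps P -> sdefinite eps Q.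
Proof. by move=> /subvP QP Pd x /QP; apply: Pd. Qed.

Lemma has_sdefiniteS eps X Y k :
  (X <= Y)%VS -> has_sdefinite eps X k -> has_sdefinite eps Y k.
Proof. by move=> XY [P [PX Pd <-]]; exists P; split=> //; apply: subv_trans XY. Qed.

Lemma has_sdefinite_leq eps X k l :
  (l <= k)%N -> has_sdefinite eps X k -> has_sdefinite eps X l.
Proof.
move=> lk [P [PX Pd dP]]; pose Q := <<take l (vbasis P)>>%VS.
have QP : (Q <= P)%VS.
  by apply/span_subvP => x /mem_take; apply: vbasis_mem.
exists Q; split; [exact: subv_trans PX | exact: sdefiniteS Pd | ].
have : free (take l (vbasis P) ++ drop l (vbasis P)).
  by rewrite cat_take_drop (basis_free (vbasisP P)).
by move/catl_free/eqP ->; rewrite size_takel // size_tuple dP.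
Qed.

Lemma sdefinite1P P : pos_definite B P <-> sdefinite 1 P.
Proof. by split=> H x xP x0; move: (H x xP x0); rewrite mul1r. Qed.

Lemma sdefiniteN1P P : neg_definite B P <-> sdefinite (-1) P.
Proof. by split=> H x xP x0; move: (H x xP x0); rewrite mulN1r oppr_gt0. Qed.

Lemma has_sdefinite0 eps X : has_sdefinite eps X 0.
Proof.
exists 0%VS; split; rewrite ?sub0v ?dimv0 // => x.
by rewrite memv0 => /eqP ->; rewrite eqxx.
Qed.

(** The zero subspace makes the maximum attained, and a definite subspace can be cut down to any
    smaller dimension. Both indices thus become thresholds, which is the form used from here on. *)
Lemma bigmax_has_sdefinite eps X (p : pred nat) k :
  (forall l, p l <-> has_sdefinite eps X l) ->
  (k <= \max_(l < (\dim X).+1 | p l) l)%N <-> has_sdefinite eps X k.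
Proof.
move=> pP; split=> [km | Hk].
  apply: has_sdefinite_leq km _.
  have p0 : p (ord0 : 'I_(\dim X).+1) by apply/pP/has_sdefinite0.
  by rewrite (bigop.bigmax_eq_arg _ p0) //; case: arg_maxnP => // l pl _; apply/pP.
have kX : (k < (\dim X).+1)%N.
  by case: (Hk) => P [PX _ <-]; rewrite ltnS dimvS.
by apply: (@leq_bigmax_cond _ _ _ (Ordinal kX)); apply/pP.
Qed.

Lemma leq_pos_index X k : (k <= pos_index B X)%N <-> has_sdefinite 1 X k.
Proof.
apply: (@bigmax_has_sdefinite 1 X
  (fun l => `[< exists P, [/\ (P <= X)%VS, pos_definite B P & \dim P = l] >])).
move=> l; split=> [/asboolP[P [PX /sdefinite1P Pd dP]] | [P [PX /sdefinite1P Pd dP]]].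
  by exists P.
by apply/asboolP; exists P.
Qed.

Lemma leq_neg_index X k : (k <= neg_index B X)%N <-> has_sdefinite (-1) X k.
Proof.
apply: (@bigmax_has_sdefinite (-1) X
  (fun l => `[< exists P, [/\ (P <= X)%VS, neg_definite B P & \dim P = l] >])).
move=> l; split=> [/asboolP[P [PX /sdefiniteN1P Pd dP]] | [P [PX /sdefiniteN1P Pd dP]]].
  by exists P.
by apply/asboolP; exists P.
Qed.

Lemma sdefinite_cap eps P Q : sdefinite eps P -> sdefinite (- eps) Q ->
  (P :&: Q = 0)%VS.
Proof.
move=> Pd Qd; apply/eqP/capv0P => x xP xQ; apply/eqP/negPn/negP => x0.
by have := Pd x xP x0; have := Qd x xQ x0; rewrite mulNr oppr_gt0 => /ltW; rewrite leNgt => /negP.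
Qed.

Lemma sdefinite_isotropic eps P x : sdefinite eps P -> x \in P -> B x x = 0 -> x = 0.
Proof.
move=> Pd xP xx0; apply/eqP/negPn/negP => x0.
by have := Pd x xP x0; rewrite xx0 mulr0 ltxx.
Qed.

Lemma sdefinite_cap_orthov eps P : sdefinite eps P -> (P :&: orthov B P = 0)%VS.
Proof.
move=> Pd; apply/eqP/capv0P => x xP /mem_orthovP xo.
exact: sdefinite_isotropic Pd xP (xo _ xP).
Qed.

Lemma addv_cap_orthov X P : (P <= X)%VS -> (P :&: orthov B P = 0)%VS ->
  (P + (X :&: orthov B P) = X)%VS.
Proof.
move=> PX P0; apply/eqP; rewrite eqEdim subv_add PX capvSl /=.
rewrite dimv_disjoint_sum ?dim_cap_orthov // 1?addnC ?dim_cap_orthov //.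
by rewrite (capvC X) capvA P0 cap0v.
Qed.

Lemma dim_capv_orthov_disj X P : (P <= X)%VS -> (P :&: orthov B P = 0)%VS ->
  (\dim P + \dim (X :&: orthov B P) = \dim X)%N.
Proof.
move=> PX P0; rewrite -{2}(addv_cap_orthov PX P0) dimv_disjoint_sum //.
by rewrite (capvC X) capvA P0 cap0v.
Qed.

Lemma sdefinite_add_line eps P y : sdefinite eps P -> 0 < eps * B y y ->
  {in P, forall u, B u y = 0} -> sdefinite eps (P + <[y]>)%VS.
Proof.
move=> Pd yy Py z /memv_addP[u uP [_ /vlineP[t ->] ->]] z0.
rewrite !formE (symformC y u) Py // !mulr0 addr0 add0r mulrDr.
have tyy : 0 <= eps * (t * (t * B y y)).
  by rewrite (mulrA t) mulrCA mulr_ge0 ?(ltW yy) // -expr2 sqr_ge0.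
have [u0 | u0] := eqVneq u 0; last by rewrite ltr_wpDr // Pd.
have t0 : t != 0 by apply: contraNneq z0 => ->; rewrite u0 add0r scale0r.
by rewrite u0 linear0l mulr0 add0r (mulrA t) mulrCA mulr_gt0 // -expr2 exprn_even_gt0 //= t0.
Qed.

Lemma dim_add_line eps P y : sdefinite eps P -> 0 < eps * B y y ->
  {in P, forall u, B u y = 0} -> \dim (P + <[y]>) = (\dim P).+1.
Proof.
move=> Pd yy Py.
have y0 : y != 0 by apply: contraTneq yy => ->; rewrite linear0l mulr0 ltxx.
rewrite dimv_disjoint_sum ?dim_vline ?y0 ?addn1 //.
apply/eqP/capv0P => z zP /vlineP[t zE]; apply: (sdefinite_isotropic Pd zP).
by rewrite {2}zE formZR (Py _ zP) mulr0.
Qed.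

(* A zero of a semidefinite form lies in the radical: otherwise
   [eps * B (t x + y) (t x + y)] takes both signs as [t] varies. *)
Lemma semidefinite_radical eps X x : eps != 0 ->
  {in X, forall y, eps * B y y <= 0} -> x \in X -> B x x = 0 -> x \in radical B X.
Proof.
move=> eps0 Xs xX xx0; apply/radicalP; split=> // y yX.
apply/eqP/negPn/negP => xy0.
have H t : eps * (2 * t * B x y + B y y) <= 0.
  have := Xs _ (memvD (memvZ t xX) yX).
  rewrite !formE xx0 (symformC y x).
  by congr (eps * _ <= _); ring.
have := H ((1 + - eps * B y y) / (2 * eps * B x y)).
have -> : eps * (2 * ((1 + - eps * B y y) / (2 * eps * B x y)) * B x y + B y y) = 1.
  by field; rewrite eps0 xy0.
by rewrite ler10.
Qed.

(** Take [P] positive definite of maximal dimension and [T] its orthogonal in [X]. By maximality the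
    form is nonpositive on [T], and nondegeneracy of [X] makes it negative definite there. *)
Lemma signature_decomposition X a b : has_signature B X a b ->
  exists P Q, [/\ sdefinite 1 P, sdefinite (-1) Q, (P <= orthov B Q)%VS,
    (P + Q = X)%VS & (\dim P = a /\ \dim Q = b)].
Proof.
move=> [/eqP/radical0P X0 <- <-].
have [P [PX Pd dP]] := (leq_pos_index X (pos_index B X)).1 (leqnn _).
have P0 := sdefinite_cap_orthov Pd.
pose T := (X :&: orthov B P)%VS.
have XE : (P + T = X)%VS by exact: addv_cap_orthov.
have PT : (P <= orthov B T)%VS.
  by rewrite orthov_sym capvSr.
have Ts : {in T, forall y, 1 * B y y <= 0}.
  move=> y yT; rewrite mul1r leNgt; apply/negP => yy.
  have /negP := ltnn (\dim P); apply.
  rewrite {2}dP; apply/leq_pos_index; exists (P + <[y]>)%VS; split.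
  - by rewrite subv_add PX -memvE; move: yT => /memv_capP[].
  - by apply: sdefinite_add_line; rewrite ?mul1r // => u uP; move/orthovP: PT; apply.
  - by apply: (dim_add_line Pd); rewrite ?mul1r // => u uP; move/orthovP: PT; apply.
have Td : sdefinite (-1) T.
  move=> y yT y0; rewrite mulN1r oppr_gt0 lt_neqAle -[X in _ && (X <= _)]mul1r Ts // andbT.
  apply: contra_neq y0 => yy0.
  have /radicalP[_ yr] := semidefinite_radical (oner_neq0 R) Ts yT yy0.
  apply: X0; first by move: yT => /memv_capP[].
  move=> z; rewrite -XE => /memv_addP[u uP [v vT ->]].
  by rewrite formDR (yr v vT) addr0 symformC; move/orthovP: PT => /(_ _ _ uP yT).
exists P, T; split=> //; split=> //.
apply/eqP; rewrite eqn_leq; apply/andP; split.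
  by apply/leq_neg_index; exists T; split=> //; apply: capvSl.
(* Any negative definite [Q] meets [P] trivially, hence has dimension at most
   [\dim X - \dim P = \dim T]. *)
have [Q [QX Qd <-]] := (leq_neg_index X (neg_index B X)).1 (leqnn _).
rewrite -(leq_add2l (\dim P)) (dim_capv_orthov_disj PX P0).
rewrite -dimv_disjoint_sum ?(sdefinite_cap Pd Qd) //.
by rewrite dimvS // subv_add PX.
Qed.

End SymmetricForms.

(** * Witt's extension theorem *)

Section Witt.
Variables (R : realType) (V : vectType R) (B : {symmetric V}).
Implicit Types (X Y Z P Q T : {vspace V}) (x y z : V) (eps : R).

(** Rank-one endomorphisms, from which the explicit isometries below are assembled. *)
Lemma exists_form_lfun x y : exists g : 'End(V), forall z, g z = B z x *: y.
Proof.
have fL : linear (fun z => B z x *: y).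
  by move=> a u v; rewrite !formE scalerDl scalerA.
exists (linfun (HB.pack_for {linear V -> V} (fun z => B z x *: y)
  (GRing.isLinear.Build R V V *:%R _ fL))) => z.
by rewrite lfunE.
Qed.

Lemma isometry_ofI X (g : 'End(V)) : radical B X = 0%VS ->
  {in X, forall x, g x \in X} -> {in X &, forall x y, B (g x) (g y) = B x y} ->
  isometry_of B X g.
Proof.
move=> /eqP/radical0P X0 gX gB; split=> //.
apply/eqP; rewrite eqEdim; apply/andP; split.
  by apply/subvP => _ /memv_imgP[x xX ->]; apply: gX.
rewrite limg_dim_eq //; apply/eqP/capv0P => x xX; rewrite memv_ker => /eqP gx0.
by apply: X0 => // y yX; rewrite -gB // gx0 linear0l.
Qed.

Lemma isometry_of_id X : isometry_of B X \1%VF.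
Proof. by split=> [|x y _ _]; rewrite ?lim1g ?id_lfunE. Qed.

Lemma isometry_of_mem X g x : isometry_of B X g -> x \in X -> g x \in X.
Proof. by move=> gI xX; rewrite -gI.1 memv_img. Qed.

Lemma isometry_of_comp X g h :
  isometry_of B X g -> isometry_of B X h -> isometry_of B X (g \o h)%VF.
Proof.
move=> gI hI; split; first by rewrite limg_comp hI.1 gI.1.
by move=> x y xX yX; rewrite !comp_lfunE gI.2 ?hI.2 ?(isometry_of_mem hI).
Qed.

(** On a nondegenerate [X], a linear functional that vanishes on [Y] but not at [x] is represented
    by a vector of [X]. *)
Lemma exists_dual X Y x : radical B X = 0%VS -> (Y <= X)%VS -> x \in X -> x \notin Y ->
  exists c, [/\ c \in X, {in Y, forall y, B c y = 0} & B c x = 1].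
Proof.
move=> /eqP/radical0P X0 YX xX xY.
pose Z := (X :&: orthov B Y)%VS.
have [[c cZ cx] | H] := pselect (exists2 c, c \in Z & B c x != 0).
  move: cZ => /memv_capP[cX /mem_orthovP cY].
  exists ((B c x)^-1 *: c); split; rewrite ?memvZ ?formZL ?mulVf //.
  by move=> y yY; rewrite formZL (cY _ yY) mulr0.
(* Otherwise [Z] is orthogonal to [T], so by nondegeneracy it pairs faithfully with a complement
   [T'] of [T] in [X]. This gives [\dim Z <= \dim X - \dim Y - 1], while [dim_cap_orthov] gives
   [\dim X - \dim Y <= \dim Z]. *)
pose T := (Y + <[x]>)%VS.
have TX : (T <= X)%VS by rewrite subv_add YX -memvE.
have dT : \dim T = (\dim Y).+1.
  rewrite dimv_disjoint_sum ?dim_vline.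
    have -> : x != 0 by apply: contraNneq xY => ->; rewrite mem0v.
    by rewrite addn1.
  apply/eqP/capv0P => z zY /vlineP[t zE]; have [t0 | t0] := eqVneq t 0.
    by rewrite zE t0 scale0r.
  by case/negP: xY; rewrite -[x](scalerK t0) -zE memvZ.
pose T' := (X :\: T)%VS.
have TT' : (T' + T = X)%VS by rewrite addv_diff; apply/addv_idPl.
have Z0 : (Z :&: orthov B T' = 0)%VS.
  apply/eqP/capv0P => z /memv_capP[zX /mem_orthovP zY] /mem_orthovP zT'.
  apply: X0 => // w; rewrite -TT' => /memv_addP[u uT' [_ /memv_addP[v vY [_ /vlineP[t ->] ->]] ->]].
  rewrite !formE zT' // zY // !add0r.
  have -> : B z x = 0; last by rewrite mulr0.
  apply/eqP/negPn/negP => zx; apply: H; exists z => //.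
  by rewrite memv_cap zX; apply/mem_orthovP.
have := dim_cap_orthov B Z T'; rewrite Z0 dimv0 add0n.
have := dim_cap_orthov B X Y; rewrite -/Z.
have := dimv_cap_compl X T; rewrite (capv_idPr TX) dT -/T'.
lia.
Qed.

(** The Eichler (Siegel) transformation, which replaces a reflection when the vector [n] is
    isotropic. It fixes every vector orthogonal to both [n] and [c]. *)
Lemma eichler_isometry X n c : radical B X = 0%VS -> n \in X -> c \in X ->
  B n n = 0 -> B c n = 0 ->
  exists g, isometry_of B X g /\
    forall z, g z = z + B z n *: c - (B z c + 2^-1 * B c c * B z n) *: n.
Proof.
move=> X0 nX cX nn cn.
have [k1 k1E] := exists_form_lfun n c; have [k2 k2E] := exists_form_lfun c n.
have [k3 k3E] := exists_form_lfun n n.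
pose g := (\1 + k1 - (k2 + (2^-1 * B c c) *: k3))%VF.
have gE z : g z = z + B z n *: c - (B z c + 2^-1 * B c c * B z n) *: n.
  rewrite !add_lfunE opp_lfunE add_lfunE scale_lfunE id_lfunE k1E k2E k3E.
  by rewrite scalerA -scalerDl.
exists g; split=> //; apply: isometry_ofI => // [x xX | x y xX yX]; rewrite !gE.
  by rewrite memvB ?memvD ?memvZ.
by rewrite !formE nn (symformC B n c) cn (symformC B c y) (symformC B n y) ; field.
Qed.

Lemma reflection_isometry X n : radical B X = 0%VS -> n \in X -> B n n != 0 ->
  exists g, isometry_of B X g /\ forall z, g z = z - (2 * B z n / B n n) *: n.
Proof.
move=> X0 nX nn.
have [k kE] := exists_form_lfun n n.
pose g := (\1 - (2 / B n n) *: k)%VF.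
have gE z : g z = z - (2 * B z n / B n n) *: n.
  by rewrite add_lfunE opp_lfunE scale_lfunE id_lfunE kE scalerA mulrAC.
exists g; split=> //; apply: isometry_ofI => // [x xX | x y xX yX]; rewrite !gE.
  by rewrite memvB ?memvZ.
by rewrite !formE (symformC B n y); field.
Qed.

(** On the hyperbolic pair this is [n |-> c n], [m |-> c^-1 m], and it is the identity on the
    orthogonal of the pair. It serves in Witt's theorem and again as the hyperbolic rotation that
    perturbs an isotropic subspace. *)
Lemma scaling_isometry X n m c : radical B X = 0%VS -> n \in X -> m \in X ->
  B n n = 0 -> B m m = 0 -> B n m = 1 -> c != 0 ->
  exists g, isometry_of B X g /\
    forall z, g z = z + ((c - 1) * B z m) *: n + ((c^-1 - 1) * B z n) *: m.
Proof.
move=> X0 nX mX nn mm nm c0.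
have [k1 k1E] := exists_form_lfun m n; have [k2 k2E] := exists_form_lfun n m.
pose g := (\1 + (c - 1) *: k1 + (c^-1 - 1) *: k2)%VF.
have gE z : g z = z + ((c - 1) * B z m) *: n + ((c^-1 - 1) * B z n) *: m.
  by rewrite !add_lfunE !scale_lfunE id_lfunE k1E k2E !scalerA.
exists g; split=> //; apply: isometry_ofI => // [x xX | x y xX yX]; rewrite !gE.
  by rewrite !memvD ?memvZ.
by rewrite !formE nn mm nm (symformC B m n) nm (symformC B n y) (symformC B m y); field.
Qed.

(** The difference [n = h - x] is orthogonal to [Y], so isometries built from [n] and from vectors
    orthogonal to [Y] fix [Y] pointwise. Three cases: [n] anisotropic (reflection), [n] isotropic
    with [x] outside [Y + <[n]>] (Eichler), and [x] inside it (scaling). *)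
Lemma witt_step X Y x h : radical B X = 0%VS -> (Y <= X)%VS ->
  x \in X -> h \in X -> x \notin Y -> h \notin Y ->
  {in Y, forall z, B h z = B x z} -> B h h = B x x ->
  exists g, [/\ isometry_of B X g, {in Y, forall z, g z = z} & g x = h].
Proof.
move=> X0 YX xX hX xY hY hxz hh; have [n nE] : exists n, n = h - x by exists (h - x).
have nX : n \in X by rewrite nE memvB.
have nY : {in Y, forall z, B z n = 0}.
  by move=> z zY; rewrite nE !formE !(symformC B z) hxz // subrr.
have hE : h = x + n by rewrite nE addrC subrK.
have xn : B n n = - 2 * B x n.
  by move: hh; rewrite hE !formE (symformC B n x) => H; lra.
have [nn | nn] := eqVneq (B n n) 0; last first.
  have [g [gI gE]] := reflection_isometry X0 nX nn.
  exists g; split=> // [z zY|]; rewrite gE.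
    by rewrite nY // mulr0 mul0r scale0r subr0.
  rewrite [2 * _](_ : _ = - B n n); last by rewrite xn; ring.
  by rewrite mulNr divff // scaleN1r opprK -hE.
have xn0 : B x n = 0.
  by apply/eqP; move: xn; rewrite nn => /eqP; rewrite eq_sym mulf_eq0 oppr_eq0 pnatr_eq0.
have [xYn | xYn] := boolP (x \in (Y + <[n]>)%VS); last first.
  have [|c [cX cYn cx]] := exists_dual X0 _ xX xYn.
    by rewrite subv_add YX -memvE.
  have cn : B c n = 0 by rewrite cYn // (subvP (addvSr _ _)) ?memv_line.
  have NcX : - c \in X by rewrite memvN.
  have Ncn : B (- c) n = 0 by rewrite formE cn oppr0.
  have [g [gI gE]] := eichler_isometry X0 nX NcX nn Ncn.
  exists g; split=> // [z zY|]; rewrite gE.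
    rewrite (nY _ zY) formNR (symformC B z c) cYn ?(subvP (addvSl _ _)) //.
    by rewrite oppr0 mulr0 !addr0 !scale0r addr0 subr0.
  rewrite xn0 mulr0 addr0 scale0r addr0 formNR (symformC B x c) cx.
  by rewrite scaleN1r opprK hE.
(* Now [x = y + l n] and [h = y + (l + 1) n] with both coefficients nonzero, so scaling [n] by
   [(l + 1) / l] suffices. The isotropic partner [m] of [n] is chosen orthogonal to [Y]. *)
move: xYn => /memv_addP[y yY [_ /vlineP[l ->] xE]].
have l0 : l != 0.
  by apply: contraNneq xY => l0; rewrite xE l0 scale0r addr0.
have l10 : l + 1 != 0.
  apply: contraNneq hY => l10; rewrite hE xE -addrA -[X in _ + (_ + X)]scale1r -scalerDl l10.
  by rewrite scale0r addr0.
have nnY : n \notin Y.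
  by apply: contraNN xY => nY'; rewrite xE memvD ?memvZ.
have [m0 [m0X m0Y m0n]] := exists_dual X0 YX nX nnY.
pose m := m0 - (2^-1 * B m0 m0) *: n.
have mX : m \in X by rewrite memvB ?memvZ.
have nm : B n m = 1 by rewrite !formE nn mulr0 subr0 symformC.
have mm : B m m = 0.
  by rewrite !formE nn (symformC B n m0) m0n; field.
have [|g [gI gE]] := @scaling_isometry X n m ((l + 1) / l) X0 nX mX nn mm nm.
  by rewrite mulf_neq0 ?invr_eq0.
have gY : {in Y, forall z, g z = z}.
  move=> z zY; rewrite gE nY // !formE nY // (symformC B z m0) m0Y //.
  by rewrite !mulr0 subrr mulr0 !scale0r !addr0.
exists g; split=> //; rewrite xE linearD linearZ /= gY // gE nn nm.
rewrite mulr0 scale0r addr0 mulr1 -{1}[n]scale1r -scalerDl addrC [1 + _]addrC subrK scalerA.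
by rewrite [l * _]mulrC divfK // hE xE scalerDl scale1r addrC addrA.
Qed.

Lemma witt X Y (f : 'End(V)) : radical B X = 0%VS -> (Y <= X)%VS ->
  {in Y, forall y, f y \in X} -> {in Y, forall y, f y = 0 -> y = 0} ->
  {in Y &, forall x y, B (f x) (f y) = B x y} ->
  exists g, isometry_of B X g /\ {in Y, forall y, g y = f y}.
Proof.
move=> X0 YX fX f0 fB.
suff H s : free s -> {subset s <= Y} ->
    exists g, isometry_of B X g /\ {in << s >>%VS, forall y, g y = f y}.
  have [||g [gI gf]] := H (vbasis Y).
  - exact: basis_free (vbasisP Y).
  - by move=> y; apply: vbasis_mem.
  by exists g; split=> //; move: gf; rewrite (span_basis (vbasisP Y)).
elim: s => [_ _|x s IHs].
  exists \1%VF; split; first exact: isometry_of_id.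
  by move=> y; rewrite span_nil memv0 => /eqP ->; rewrite !linear0.
rewrite free_cons => /andP[xs fs] xsY.
have [|g [gI gf]] := IHs fs; first by move=> y ys; apply: xsY; rewrite inE ys orbT.
have sY : (<< s >> <= Y)%VS.
  by apply/span_subvP => y ys; apply: xsY; rewrite inE ys orbT.
have xY : x \in Y by apply: xsY; rewrite mem_head.
have : f x \in X by apply: fX.
(* Here [h] is the preimage of [f x] under the isometry [g] already found. It remains to move [x] to
   [h] while fixing the span of [s], and then to apply [g]. *)
rewrite -{1}gI.1 => /memv_imgP[h hX fxE].
have YXm : {subset Y <= X} by apply/subvP.
have hs : h \notin << s >>%VS.
  apply: contraNN xs => hs.
  suff -> : x = h by [].
  apply/eqP; rewrite -subr_eq0; apply/eqP/f0.
    by rewrite memvB // (subvP sY).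
  by rewrite linearB /= fxE gf // subrr.
have [z zs||] := @witt_step X << s >>%VS x h X0 (subv_trans sY YX) (YXm _ xY) hX xs hs.
- have zY := subvP sY _ zs.
  by rewrite -(gI.2 h z) ?(YXm z zY) // -fxE gf // fB.
- by rewrite -(gI.2 h h) // -fxE fB.
move=> k [kI ks kx]; exists (g \o k)%VF; split; first exact: isometry_of_comp.
move=> y; rewrite span_cons => /memv_addP[_ /vlineP[t ->] [z zs ->]].
by rewrite comp_lfunE !linearD !linearZ /= kx ks // -fxE gf.
Qed.

End Witt.

(** * Sylvester's law of inertia *)

Section Sylvester.
Variables (R : realType) (V : vectType R) (B : {symmetric V}).
Implicit Types (X Y Z P Q T : {vspace V}) (x y z e : V) (eps : R).

(** The equation [eps * eps = 1] encodes that [eps] is a sign, so that both signs are treated by the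
    same argument. *)
Lemma normalize_vector eps x : eps * eps = 1 -> 0 < eps * B x x ->
  exists2 t, t != 0 & B (t *: x) (t *: x) = eps.
Proof.
move=> ee xx; pose t := Num.sqrt (eps * B x x).
have t0 : t != 0 by rewrite gt_eqF // sqrtr_gt0.
have tt : t * t = eps * B x x by rewrite -expr2 sqr_sqrtr // ltW.
exists t^-1; first by rewrite invr_eq0.
have e0 : eps != 0 by apply: contra_eq_neq ee => ->; rewrite mul0r eq_sym oner_neq0.
rewrite !formE mulrA -invfM tt; apply: (mulfI e0); rewrite ee mulrCA mulVf //.
by rewrite gt_eqF.
Qed.

Lemma has_sdefinite_unit eps X : eps * eps = 1 -> has_sdefinite B eps X 1 ->
  exists2 e, e \in X & B e e = eps.
Proof.
move=> ee [P [PX Pd dP]].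
have P0 : P != 0%VS by rewrite -dimv_eq0 dP.
have xP := memv_pick P.
have [|t _ tE] := normalize_vector ee (_ : 0 < eps * B (vpick P) (vpick P)).
  by apply: Pd; rewrite ?vpick0.
by exists (t *: vpick P); rewrite // memvZ // (subvP PX).
Qed.

Lemma dim_cap_orthov_line X e : (\dim X <= (\dim (X :&: orthov B <[e]>)).+1)%N.
Proof.
apply: leq_trans (dim_cap_orthov B X <[e]>) _.
by rewrite dim_vline -addn1 leq_add2l leq_b1.
Qed.

Lemma has_sdefinite_split_pos eps X e k : eps * eps = 1 -> e \in X -> B e e = eps ->
  has_sdefinite B eps X k.+1 <-> has_sdefinite B eps (X :&: orthov B <[e]>)%VS k.
Proof.
move=> ee eX eB; split=> [[P [PX Pd dP]] | [P [PT Pd dP]]].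
  apply: (@has_sdefinite_leq _ _ _ _ _ (\dim (P :&: orthov B <[e]>))).
    by rewrite -ltnS -dP dim_cap_orthov_line.
  exists (P :&: orthov B <[e]>)%VS; split=> //; first exact: capvS.
  exact: sdefiniteS (capvSl _ _) Pd.
have ePo : {in P, forall u, B u e = 0}.
  by move=> u /(subvP PT)/memv_capP[_]; rewrite mem_orthov1 => /eqP.
have ep : 0 < eps * B e e by rewrite eB ee ltr01.
exists (P + <[e]>)%VS; split; last by rewrite (dim_add_line Pd ep ePo) dP.
  by rewrite subv_add -memvE eX (subv_trans PT (capvSl _ _)).
exact: sdefinite_add_line.
Qed.

(** Projecting along [e] adds the square of [B z e] to [- eps * B z z], so a subspace definite of
    the opposite sign projects injectively onto one that is still definite and orthogonal to [e]. *)
Lemma has_sdefinite_split_neg eps X e k : eps * eps = 1 -> e \in X -> B e e = eps ->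
  has_sdefinite B (- eps) X k <-> has_sdefinite B (- eps) (X :&: orthov B <[e]>)%VS k.
Proof.
move=> ee eX eB; split; last by apply: has_sdefiniteS; apply: capvSl.
move=> [P [PX Pd dP]].
have [k1 k1E] := exists_form_lfun B e e.
pose f := (\1 - eps *: k1)%VF.
have fE z : f z = z - (eps * B z e) *: e.
  by rewrite add_lfunE opp_lfunE scale_lfunE id_lfunE k1E scalerA.
have fB z : - eps * B (f z) (f z) = - eps * B z z + B z e * B z e.
  rewrite fE !formE eB (symformC B e z); ring: ee.
have f0 : (P :&: lker f = 0)%VS.
  apply/eqP/capv0P => x xP; rewrite memv_ker => /eqP fx0.
  apply/eqP/negPn/negP => x0.
  have := Pd x xP x0; have := fB x; rewrite fx0 linear0l mulr0 => fBx.
  rewrite -(ltrD2r (B x e * B x e)) add0r -fBx ltNge.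
  by rewrite -expr2 sqr_ge0.
exists (f @: P)%VS; split.
- apply/subvP => _ /memv_imgP[x xP ->].
  have xX := subvP PX _ xP.
  rewrite memv_cap fE memvB ?memvZ //= mem_orthov1 !formE eB.
  by rewrite mulrAC ee mul1r subrr.
- move=> _ /memv_imgP[x xP ->] fx0.
  rewrite fB ltr_wpDr -?expr2 ?sqr_ge0 // Pd //.
  by apply: contraNneq fx0 => ->; rewrite linear0.
- by rewrite limg_dim_eq.
Qed.

Lemma exists_lfun_limg X Y : \dim X = \dim Y -> exists f : 'End(V), (f @: X = Y)%VS.
Proof.
move=> dXY; have [f fE] := linear_of_free (vbasis X) (vbasis Y).
exists (linfun f).
rewrite -{1}(span_basis (vbasisP X)) limg_span.
rewrite (_ : map _ _ = vbasis Y) ?(span_basis (vbasisP Y)) //.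
rewrite -fE ?(basis_free (vbasisP X)) ?size_tuple //.
by apply: eq_map => x; rewrite lfunE.
Qed.

(** With no definite line of either sign every vector is isotropic, and polarization concludes. *)
Lemma null_form X : (forall eps, eps * eps = 1 -> ~ has_sdefinite B eps X 1) ->
  {in X &, forall x y, B x y = 0}.
Proof.
move=> nX; have H x : x \in X -> B x x = 0.
  move=> xX; apply/eqP/negPn/negP => xx.
  have x0 : x != 0 by apply: contraNneq xx => ->; rewrite linear0l.
  have H eps : eps * eps = 1 -> 0 < eps * B x x -> False.
    move=> ee ex; apply: (nX _ ee); exists <[x]>%VS; split.
    - by rewrite -memvE.
    - move=> _ /vlineP[t ->] tx0; rewrite !formE mulrCA [t * B x x]mulrC !mulrA mulrAC.
      have t0 : t != 0 by apply: contraNneq tx0 => ->; rewrite scale0r.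
      rewrite [t * eps]mulrC -[eps * t * t]mulrA mulrAC mulr_gt0 // -expr2.
      by rewrite exprn_even_gt0 //= t0.
    - by rewrite dim_vline x0.
  have [xp | xn | /eqP] := ltrgt0P (B x x); last by rewrite (negPf xx).
    by apply: (H 1); rewrite ?mulr1 ?mul1r.
  by apply: (H (-1)); rewrite ?mulrNN ?mulr1 // mulN1r oppr_gt0.
move=> x y xX yX; have := H _ (memvD xX yX).
rewrite !formE !H // (symformC B y x) => E; lra.
Qed.

(** [X] and [Y] may be degenerate, since projections of isotropic subspaces can be. Unit vectors of
    equal sign are split off one at a time; once none is left, both forms vanish and any linear
    bijection will do. *)
Lemma sylvester X Y : \dim X = \dim Y ->
  (forall eps (k : nat), eps * eps = 1 -> has_sdefinite B eps X k <-> has_sdefinite B eps Y k) ->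
  exists f : 'End(V), (f @: X = Y)%VS /\ {in X &, forall x y, B (f x) (f y) = B x y}.
Proof.
have [n] := ubnP (\dim X); elim: n X Y => // n IHn X Y dX dXY hXY.
have [[eps [ee Xe]] | nX] :=
    pselect (exists eps, eps * eps = 1 /\ has_sdefinite B eps X 1); last first.
  have X0 : {in X &, forall x y, B x y = 0}.
    by apply: null_form => eps ee He; apply: nX; exists eps.
  have Y0 : {in Y &, forall x y, B x y = 0}.
    by apply: null_form => eps ee /hXY He; apply: nX; exists eps; split=> //; apply: He.
  have [f fXY] := exists_lfun_limg dXY.
  exists f; split=> // x y xX yX.
  by rewrite (X0 x y) // Y0 // -fXY memv_img.
have [e eX eB] := has_sdefinite_unit ee Xe.
have [e' e'Y e'B] := has_sdefinite_unit ee ((hXY _ _ ee).1 Xe).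
have eps0 : eps != 0 by apply: contra_eq_neq ee => ->; rewrite mul0r eq_sym oner_neq0.
have line_cap z : B z z = eps -> (<[z]> :&: orthov B <[z]> = 0)%VS.
  move=> zB; apply: (@sdefinite_cap_orthov _ _ B eps) => _ /vlineP[t ->] tz0.
  rewrite !formE zB mulrCA [eps * _]mulrCA ee mulr1 -expr2 exprn_even_gt0 //=.
  by apply: contraNneq tz0 => ->; rewrite scale0r.
pose T := (X :&: orthov B <[e]>)%VS; pose T' := (Y :&: orthov B <[e']>)%VS.
have dline z Z : B z z = eps -> z \in Z ->
    (\dim (Z :&: orthov B <[z]>)).+1 = \dim Z.
  move=> zB zZ; rewrite -(@dim_capv_orthov_disj _ _ B Z <[z]>) ?line_cap -?memvE //.
  rewrite dim_vline (_ : z != 0) ?add1n //.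
  by apply: contra_eq_neq zB => ->; rewrite linear0l eq_sym.
have dT := dline _ _ eB eX; have dT' := dline _ _ e'B e'Y.
have [||eps' k ee'|f [fT fB]] := IHn T T'.
- by rewrite -ltnS dT.
- by apply/eq_add_S; rewrite dT dT'.
- have [-> | ->] : eps' = eps \/ eps' = - eps.
    have /eqP : (eps' - eps) * (eps' + eps) = 0 by ring: ee ee'.
    rewrite mulf_eq0 subr_eq0 addr_eq0 => /orP[] /eqP; [by left | by right].
  + by rewrite -!has_sdefinite_split_pos //; apply: hXY.
  + by rewrite -!has_sdefinite_split_neg //; apply: hXY; rewrite mulrNN.
have [k kE] := exists_form_lfun B e e; have [k' k'E] := exists_form_lfun B e e'.
(* [g] sends [e] to [e'] and acts as [f] on [h x], the component of [x] orthogonal to [e]. *)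
pose g := (eps *: k' + (f \o (\1 - eps *: k)))%VF.
pose h x := x - (eps * B x e) *: e.
have gE x : g x = (eps * B x e) *: e' + f (h x).
  by rewrite add_lfunE scale_lfunE k'E comp_lfunE add_lfunE opp_lfunE scale_lfunE id_lfunE kE !scalerA.
have hT x : x \in X -> h x \in T.
  move=> xX; rewrite memv_cap memvB ?memvZ //= mem_orthov1 !formE eB.
  by rewrite mulrAC ee mul1r subrr.
have fT' x : x \in T -> f x \in Y /\ B (f x) e' = 0.
  move=> xT; have : f x \in T' by rewrite -fT memv_img.
  by move=> /memv_capP[-> ]; rewrite mem_orthov1 => /eqP.
have gB : {in X &, forall x y, B (g x) (g y) = B x y}.
  move=> x y xX yX; rewrite !gE.
  have [_ fx] := fT' _ (hT x xX); have [_ fy] := fT' _ (hT y yX).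
  rewrite !(formDL, formDR) fB ?hT // !(formZL, formZR) fx (symformC B e') fy.
  by rewrite /h !formE eB e'B (symformC B e y); ring: ee.
exists g; split=> //; apply/eqP; rewrite eqEsubv; apply/andP; split.
  apply/subvP => _ /memv_imgP[x xX ->]; rewrite gE memvD ?memvZ //.
  by case: (fT' _ (hT x xX)).
have e'E : e' \in (g @: X)%VS.
  suff -> : e' = g e by apply: memv_img.
  by rewrite gE /h eB ee !scale1r subrr linear0 addr0.
rewrite -(@addv_cap_orthov _ _ B Y <[e']>) ?line_cap -?memvE //.
rewrite subv_add -memvE e'E -/T' -fT.
apply/subvP => _ /memv_imgP[x xT ->].
have xe : B x e = 0 by move: xT => /memv_capP[_]; rewrite mem_orthov1 => /eqP.
have -> : f x = g x by rewrite gE /h xe mulr0 !scale0r add0r subr0.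
by apply: memv_img; move: xT => /memv_capP[].
Qed.

End Sylvester.

(** * Projections of isotropic subspaces *)

Section OrthogonalDecomposition.
Variables (R : realType) (V : vectType R) (B : {symmetric V}).
Implicit Types (U W X Y Z P Q T S : {vspace V}) (x y z e s : V) (eps : R).

Definition orth_decomp U W :=
  [/\ (U + W)%VS = fullv, (U :&: W)%VS = 0%VS & (U <= orthov B W)%VS].

Lemma orth_decomp_sym U W : orth_decomp U W -> orth_decomp W U.
Proof. by case=> UW UW0 UoW; split; rewrite 1?addvC 1?capvC 1?orthov_sym. Qed.

Section Fixed.
Variables (U W : {vspace V}).
Hypothesis UW : orth_decomp U W.
Local Notation pU := (daddv_pi U W).
Local Notation pW := (daddv_pi W U).

Let UW0 : (U :&: W = 0)%VS. Proof. by case: UW. Qed.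
Let WU0 : (W :&: U = 0)%VS. Proof. by rewrite capvC. Qed.

Lemma compl_pi_add x : pU x + pW x = x.
Proof. by case: UW => sumE _ _; apply: daddv_pi_add; rewrite ?sumE ?memvf. Qed.

Lemma compl_pi_id x : x \in U -> pU x = x.
Proof. exact: daddv_pi_id. Qed.

Lemma compl_pi_eq0 x : x \in W -> pU x = 0.
Proof.
move=> xW; have := compl_pi_add x; rewrite (daddv_pi_id WU0 xW) => /(canRL (addrK x)).
by rewrite subrr.
Qed.

Lemma compl_pi_eq0_mem x : pU x = 0 -> x \in W.
Proof. by move=> x0; rewrite -(compl_pi_add x) x0 add0r memv_pi. Qed.

Lemma form_UW x y : x \in U -> y \in W -> B x y = 0.
Proof. by move=> xU yW; case: UW => _ _ /orthovP; apply. Qed.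

Lemma form_pi x y : B x y = B (pU x) (pU y) + B (pW x) (pW y).
Proof.
rewrite -{1}(compl_pi_add x) -{1}(compl_pi_add y) !formE.
rewrite (symformC B (pW x) (pU y)) (form_UW (memv_pi U W x) (memv_pi W U y)).
rewrite (form_UW (memv_pi U W y) (memv_pi W U x)).
by rewrite addr0 add0r.
Qed.

(** The two components of the form cancel on an isotropic subspace. This is what ties its projection
    to [W] to its projection to [U]. *)
Lemma isotropic_pi S : totally_isotropic B S ->
  {in S &, forall x y, B (pW x) (pW y) = - B (pU x) (pU y)}.
Proof.
move=> /orthovP SS x y xS yS; apply/eqP; rewrite -addr_eq0 addrC -form_pi.
by rewrite SS.
Qed.

Lemma proj_toE S : proj_to U W S = (pU @: S)%VS.
Proof.
apply/vspaceP => x; apply/idP/idP.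
  move=> /memv_capP[/memv_addP[s sS [w wW ->]] sU].
  rewrite -(compl_pi_id sU) linearD /= (compl_pi_eq0 wW) addr0.
  exact: memv_img.
move=> /memv_imgP[s sS ->]; rewrite memv_cap memv_pi andbT.
by rewrite -[pU s](addrK (pW s)) compl_pi_add memvD ?(subvP (addvSl _ _) _ sS) // memvN (subvP (addvSr _ _)) ?memv_pi.
Qed.

Lemma mem_proj_to S s : s \in S -> pU s \in proj_to U W S.
Proof. by move=> sS; rewrite proj_toE memv_img. Qed.

Lemma proj_toP S x : reflect (exists2 s, s \in S & x = pU s) (x \in proj_to U W S).
Proof. by rewrite proj_toE; apply: memv_imgP. Qed.

Lemma dim_proj_to S : (\dim (proj_to U W S) + \dim (S :&: W) = \dim S)%N.
Proof.
rewrite proj_toE -(limg_ker_dim pU S) addnC; congr (\dim _ + _)%N.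
apply/vspaceP => x; rewrite !memv_cap memv_ker; congr (_ && _).
by apply/idP/eqP => [/compl_pi_eq0|/compl_pi_eq0_mem].
Qed.

Lemma isometry_prodI g h : isometry_of B U g -> isometry_of B W h ->
  exists2 k, isometry_prod B U W k & forall x, k x = g (pU x) + h (pW x).
Proof.
move=> gI hI; pose k := ((g \o pU) + (h \o pW))%VF.
have kE x : k x = g (pU x) + h (pW x) by rewrite add_lfunE !comp_lfunE.
have kU : {in U, k =1 g}.
  move=> x xU; rewrite kE compl_pi_id //.
  have -> : pW x = 0 by rewrite -[pW x](addKr (pU x)) compl_pi_add compl_pi_id // addNr.
  by rewrite linear0 addr0.
have kW : {in W, k =1 h}.
  by move=> x xW; rewrite kE compl_pi_eq0 // (daddv_pi_id WU0 xW) linear0 add0r.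
exists k => //; split; split.
- by rewrite (eq_in_limg kU) gI.1.
- by move=> x y xU yU; rewrite !kU //; apply: gI.2.
- by rewrite (eq_in_limg kW) hI.1.
- by move=> x y xW yW; rewrite !kW //; apply: hI.2.
Qed.

End Fixed.

Lemma has_sdefinite_proj_swap U W S eps k : orth_decomp U W ->
  totally_isotropic B S -> has_sdefinite B eps (proj_to U W S) k ->
  has_sdefinite B (- eps) (proj_to W U S) k.
Proof.
move=> UW Siso [P [PX Pd <-]]; have WU := orth_decomp_sym UW.
have [l lP] := linear_section (daddv_pi U W) S.
have lS x : x \in P -> l x \in S /\ daddv_pi U W (l x) = x.
  by move=> /(subvP PX); rewrite proj_toE // => /lP.
pose f := (daddv_pi W U \o l)%VF.
have fB x : x \in P -> B (f x) (f x) = - B x x.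
  by move=> xP; have [lx lxE] := lS x xP; rewrite comp_lfunE (isotropic_pi UW Siso) // lxE.
exists (f @: P)%VS; split.
- apply/subvP => _ /memv_imgP[x xP ->]; rewrite comp_lfunE.
  by apply: mem_proj_to => //; case: (lS x xP).
- move=> _ /memv_imgP[x xP ->] fx0; rewrite fB // mulrNN; apply: Pd => //.
  by apply: contraNneq fx0 => ->; rewrite linear0.
- apply: limg_dim_eq; apply/eqP/capv0P => x xP; rewrite memv_ker => /eqP fx0.
  apply: (sdefinite_isotropic Pd xP); apply/eqP.
  by rewrite -oppr_eq0 -fB // fx0 linear0l.
Qed.

(** The inclusion of the radical in [S] expresses [a = 0]. If the [W]-component of [s] is in the
    radical of its projection, then so is the [U]-component, by [isotropic_pi]; the latter lies in
    [S], hence so does their difference from [s]. *)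
Lemma radical_proj_swap U W S : orth_decomp U W -> totally_isotropic B S ->
  (radical B (proj_to U W S) <= S)%VS -> (radical B (proj_to W U S) <= S)%VS.
Proof.
move=> UW Siso rS; have WU := orth_decomp_sym UW.
apply/subvP => _ /radicalP[/(proj_toP WU)[s sS ->] wr].
rewrite -[daddv_pi W U s](addKr (daddv_pi U W s)) compl_pi_add // addrC memvB //.
apply: (subvP rS); apply/radicalP; split; first exact: mem_proj_to.
move=> _ /(proj_toP UW)[t tS ->]; apply/eqP; rewrite -oppr_eq0 -(isotropic_pi UW Siso) //.
by rewrite wr // mem_proj_to.
Qed.

(** Since [S' :&: W = 0], each [f (pU s)] has a unique lift to [S']. The map from [S] to [S'] so
    obtained preserves the form on each component, and Witt's theorem extends its two components to
    [U] and [W]. *)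
Lemma isometry_prod_transitive U W S S' : orth_decomp U W ->
  radical B U = 0%VS -> radical B W = 0%VS ->
  totally_isotropic B S -> totally_isotropic B S' -> \dim S = \dim S' ->
  (S :&: W = 0)%VS -> (S' :&: W = 0)%VS ->
  (radical B (proj_to U W S) <= S)%VS -> (radical B (proj_to U W S') <= S')%VS ->
  (forall eps (k : nat), eps * eps = 1 ->
     has_sdefinite B eps (proj_to U W S) k <-> has_sdefinite B eps (proj_to U W S') k) ->
  exists2 g, isometry_prod B U W g & (g @: S)%VS = S'.
Proof.
move=> UW U0 W0 Siso S'iso dS SW S'W rS rS' hSS'.
have WU := orth_decomp_sym UW; have [_ UW0 UoW] := UW.
set pU := daddv_pi U W; set pW := daddv_pi W U.
pose P := proj_to U W S; pose P' := proj_to U W S'.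
have [|f [fP fB]] := @sylvester _ _ B P P' _ hSS'.
  apply/eqP; rewrite -(eqn_add2r (\dim (S :&: W))) dim_proj_to // dS.
  by rewrite SW -S'W dim_proj_to.
have PU : (P <= U)%VS by apply: capvSr.
have P'U : (P' <= U)%VS by apply: capvSr.
have f0 x : x \in P -> f x = 0 -> x = 0.
  have dP : \dim (f @: P) = \dim P.
    by rewrite fP; apply/eqP; rewrite -(eqn_add2r (\dim (S :&: W))) dim_proj_to // dS
       SW -S'W dim_proj_to.
  have := limg_ker_dim f P; rewrite dP => /(canRL (addnK _)); rewrite subnn => /eqP.
  rewrite dimv_eq0 => /capv0P H xP fx0; apply: H => //.
  by rewrite memv_ker fx0.
have fP' x : x \in P -> f x \in P' by move=> xP; rewrite -fP memv_img.
have frad x : x \in P -> (f x \in radical B P') = (x \in radical B P).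
  move=> xP; apply/radicalP/radicalP => -[_ xr]; split; rewrite ?fP' //.
    by move=> y yP; rewrite -fB // xr // fP'.
  by move=> y; rewrite -fP => /memv_imgP[z zP ->]; rewrite fB // xr.
have SP s : s \in S -> pU s \in P by apply: mem_proj_to.
have [l lP] := linear_section pW S; have [l' l'P] := linear_section pU S'.
have l'S x : x \in P -> l' (f x) \in S' /\ pU (l' (f x)) = f x.
  by move=> xP; apply: l'P; rewrite -proj_toE // fP'.
have lS s : s \in S -> l (pW s) \in S /\ pW (l (pW s)) = pW s.
  by move=> sS; apply: lP; rewrite memv_img.
(* Both [f d] and its lift belong to [S'] and have the same [U]-component, so they differ by an
   element of [S' :&: W = 0]. *)
have l'fix d : d \in P -> d \in radical B P -> l' (f d) = f d.
  move=> dP dr; have [l'd1 l'd2] := l'S d dP.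
  apply/eqP; rewrite -subr_eq0; apply/eqP; move/eqP/capv0P: S'W; apply.
    by rewrite memvB // (subvP rS') // frad.
  apply: (compl_pi_eq0_mem UW); rewrite linearB /= l'd2 compl_pi_id ?subrr //.
  exact: (subvP P'U _ (fP' _ dP)).
pose fW := (pW \o l' \o f \o pU \o l)%VF.
(* The value must depend on [pW s] only. Two lifts of [pW s] to [S] differ by some [d] in [S :&: U],
   which lies in the radical; by [l'fix] it contributes [f d], a vector of [U] that [pW] kills. *)
have fWE s : s \in S -> fW (pW s) = pW (l' (f (pU s))).
  move=> sS; have [l1 l2] := lS s sS; rewrite !comp_lfunE.
  have [d dE] : exists d, d = s - l (pW s) by exists (s - l (pW s)).
  have dS' : d \in S by rewrite dE memvB.
  have dU : d \in U by apply: (compl_pi_eq0_mem WU); rewrite dE linearB /= l2 subrr.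
  have dr : d \in radical B P.
    by apply: (subvP (cap_sub_radical_proj UoW Siso)); rewrite memv_cap dS'.
  have dP : d \in P by case/radicalP: dr.
  have -> : pU s = d + pU (l (pW s)).
    by rewrite -{1}[s](subrK (l (pW s))) -dE linearD /= (compl_pi_id UW dU).
  rewrite !linearD /= l'fix //.
  by rewrite (compl_pi_eq0 WU (subvP P'U _ (fP' _ dP))) add0r.
have [|||gU [gUI gUE]] := @witt _ _ B U P f U0 PU.
- by move=> x /fP' /(subvP P'U).
- exact: f0.
- exact: fB.
have [|||gW [gWI gWE]] := @witt _ _ B W (proj_to W U S) fW W0 (capvSr _ _).
- by move=> x _; rewrite !comp_lfunE memv_pi.
(* Injectivity: a zero [W]-component puts [f (pU s)] in [S' :&: U], hence in the radical of [P']. So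
   [pU s] is in the radical of [P], thus in [S], and [pW s] lies in [S :&: W = 0]. *)
- move=> _ /(proj_toP WU)[s sS ->]; rewrite fWE // => w0.
  have [l1 l2] := l'S _ (SP s sS).
  have lU := compl_pi_eq0_mem WU w0.
  have fr : f (pU s) \in radical B P'.
    rewrite -l2 (compl_pi_id UW lU).
    by apply: (subvP (cap_sub_radical_proj UoW S'iso)); rewrite memv_cap l1.
  rewrite frad ?SP // in fr.
  have := subvP rS _ fr => pS.
  move/eqP/capv0P: SW; apply; last exact: memv_pi.
  by rewrite -[daddv_pi W U s](addKr (pU s)) compl_pi_add // addrC memvB.
- move=> _ _ /(proj_toP WU)[s sS ->] /(proj_toP WU)[t tS ->]; rewrite !fWE //.
  have [l1 l2] := l'S _ (SP s sS); have [m1 m2] := l'S _ (SP t tS).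
  by rewrite (isotropic_pi UW S'iso l1 m1) (isotropic_pi UW Siso sS tS) l2 m2 fB ?SP.
have [g gI gE] := isometry_prodI UW gUI gWI.
have gS s : s \in S -> g s = l' (f (pU s)).
  move=> sS; rewrite gE gUE ?SP // gWE ?mem_proj_to // fWE //.
  by have [_ {1}<-] := l'S _ (SP s sS); apply: compl_pi_add.
exists g => //; apply/eqP; rewrite eqEdim; apply/andP; split.
  by apply/subvP => _ /memv_imgP[s sS ->]; rewrite gS //; case: (l'S _ (SP s sS)).
rewrite -dS limg_dim_eq //; apply/eqP/capv0P => s sS; rewrite memv_ker gS // => /eqP l'0.
have [_] := l'S _ (SP s sS); rewrite l'0 linear0 => /esym/(f0 _ (SP s sS)) /(compl_pi_eq0_mem UW) sW.
by move/eqP/capv0P: SW; apply.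
Qed.

End OrthogonalDecomposition.

(** * Isotropic subspaces with prescribed lower bounds on the indices *)

Section IsotropicSubspaces.
Variables (R : realType) (V : vectType R) (B : {symmetric V}).
Implicit Types (U W X Y Z P Q T S : {vspace V}) (x y z e s : V) (eps : R).

Lemma has_sdefinite_dim_pos eps P : sdefinite B eps P -> (0 < \dim P)%N ->
  has_sdefinite B eps P 1.
Proof. by move=> Pd dP; apply: has_sdefinite_leq dP _; exists P; split. Qed.

(** While [\dim S] is below both [\dim P] and [\dim Q], there are unit vectors [e] in [P] and [f] in
    [Q] orthogonal to [S], of norms 1 and -1. The isotropic vector [e + f] enlarges [S]: it pairs to
    1 with [e], which is orthogonal to [S]. *)
Lemma extend_isotropic P Q S0 k : sdefinite B 1 P -> sdefinite B (-1) Q ->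
  (P <= orthov B Q)%VS -> totally_isotropic B S0 ->
  (\dim S0 <= k)%N -> (k <= minn (\dim P) (\dim Q))%N ->
  exists S, [/\ (S0 <= S)%VS, (S <= S0 + (P + Q))%VS, totally_isotropic B S & \dim S = k].
Proof.
move=> Pd Qd PQ S0iso; elim: k => [|k IHk].
  by rewrite leqn0 => /eqP dS0 _; exists S0; split; rewrite ?addvSl.
rewrite leq_eqVlt => /orP[/eqP <- _|]; first by exists S0; split; rewrite ?addvSl.
rewrite ltnS => S0k kPQ; have [S [S0S SPQ Siso dS]] := IHk S0k (ltnW kPQ).
have pick_unit eps T : eps * eps = 1 -> sdefinite B eps T -> (k < \dim T)%N ->
    exists2 e, e \in (T :&: orthov B S)%VS & B e e = eps.
  move=> ee Td dT; apply: (has_sdefinite_unit ee).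
  apply: has_sdefinite_dim_pos; first exact: sdefiniteS (capvSl _ _) Td.
  have := dim_cap_orthov B T S; rewrite dS; lia.
have [e /memv_capP[eP /mem_orthovP eS] ee] : exists2 e, e \in (P :&: orthov B S)%VS & B e e = 1.
  by apply: pick_unit; rewrite ?mulr1 //; lia.
have [f /memv_capP[fQ /mem_orthovP fS] ff] : exists2 e, e \in (Q :&: orthov B S)%VS & B e e = -1.
  by apply: pick_unit; rewrite ?mulrNN ?mulr1 //; lia.
have ef : B e f = 0 by move/orthovP: PQ; apply.
have [v vE] : exists v, v = e + f by exists (e + f).
have vS : {in S, forall x, B v x = 0}.
  by move=> x xS; rewrite vE formDL eS // fS // addr0.
have vv : B v v = 0 by rewrite vE !formE ee ff (symformC B f e) ef; ring.
have vNS : v \notin S.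
  apply/negP => /eS; rewrite vE formDR ee ef addr0 => /eqP.
  by rewrite oner_eq0.
exists (S + <[v]>)%VS; split.
- exact: subv_trans (addvSl _ _).
- rewrite subv_add SPQ -memvE.
  by rewrite vE (subvP (addvSr _ _)) // memv_add.
- apply/orthovP => x y /memv_addP[x1 x1S [_ /vlineP[a ->] ->]].
  move=> /memv_addP[y1 y1S [_ /vlineP[b ->] ->]].
  rewrite !formE (symformC B x1 v) (vS _ x1S) (vS _ y1S) vv.
  by move/orthovP: Siso => /(_ _ _ x1S y1S) ->; rewrite !mulr0 !addr0.
- rewrite dimv_disjoint_sum ?dS ?dim_vline.
    by rewrite (_ : v != 0) ?addn1 //; apply: contraNneq vNS => ->; rewrite mem0v.
  apply/eqP/capv0P => x xS /vlineP[a xE]; have [a0 | a0] := eqVneq a 0.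
    by rewrite xE a0 scale0r.
  by case/negP: vNS; rewrite -[v](scalerK a0) -xE memvZ.
Qed.

(** A vector of [S] killed by the projection to [U] would be an isotropic vector of the definite
    space [Q]. *)
Lemma has_sdefinite_proj U W P Q S eps : orth_decomp B U W ->
  (P <= U)%VS -> (Q <= W)%VS -> sdefinite B eps P -> sdefinite B (- eps) Q ->
  totally_isotropic B S -> (S <= P + Q)%VS ->
  has_sdefinite B eps (proj_to U W S) (\dim S).
Proof.
move=> UW PU QW Pd Qd /orthovP Siso SPQ; rewrite (proj_toE UW).
have WU := orth_decomp_sym UW.
have pP s : s \in S -> daddv_pi U W s \in P /\ daddv_pi W U s \in Q.
  move=> /(subvP SPQ)/memv_addP[a aP [b bQ ->]]; rewrite !linearD /=.
  rewrite (compl_pi_id UW (subvP PU _ aP)) (compl_pi_eq0 UW (subvP QW _ bQ)) addr0.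
  by rewrite (compl_pi_eq0 WU (subvP PU _ aP)) (compl_pi_id WU (subvP QW _ bQ)) add0r.
exists (daddv_pi U W @: S)%VS; split=> //.
  apply: sdefiniteS Pd; apply/subvP => _ /memv_imgP[s sS ->].
  by case: (pP s sS).
apply: limg_dim_eq; apply/eqP/capv0P => s sS; rewrite memv_ker => /eqP s0.
have [_ sQ] := pP s sS.
move: sQ; rewrite -[daddv_pi W U s]add0r -{1}s0 (compl_pi_add UW) => sQ.
exact: (sdefinite_isotropic Qd sQ (Siso _ _ sS sS)).
Qed.

Lemma proj_toS U W S T : (S <= T)%VS -> (proj_to U W S <= proj_to U W T)%VS.
Proof. by move=> ST; rewrite capvS // addvS. Qed.

(** An isotropic [A] in [P1 + Q2] contributes [k] positive dimensions, an isotropic [C] in [P2 + Q1]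
    contributes [l] negative ones, and they are mutually orthogonal. Extending [A + C] to dimension
    [r] in the whole space can only enlarge the projection. *)
Lemma exists_isotropic U W p q p1 q1 p2 q2 r k l : orth_decomp B U W ->
  has_signature B fullv p q -> has_signature B U p1 q1 -> has_signature B W p2 q2 ->
  (k <= minn p1 q2)%N -> (l <= minn q1 p2)%N -> (k + l <= r)%N -> (r <= minn p q)%N ->
  exists2 S, isoGr B r S &
    has_sdefinite B 1 (proj_to U W S) k /\ has_sdefinite B (-1) (proj_to U W S) l.
Proof.
move=> UW hV hU hW hk hl hkl hr; have [_ _ UoW] := UW.
have [P1 [Q1 [P1d Q1d PQ1 PQU [dP1 dQ1]]]] := signature_decomposition hU.
have [P2 [Q2 [P2d Q2d PQ2 PQW [dP2 dQ2]]]] := signature_decomposition hW.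
have [P [Q [Pd Qd PQ _ [dP dQ]]]] := signature_decomposition hV.
have P1U : (P1 <= U)%VS by rewrite -PQU addvSl.
have Q1U : (Q1 <= U)%VS by rewrite -PQU addvSr.
have P2W : (P2 <= W)%VS by rewrite -PQW addvSl.
have Q2W : (Q2 <= W)%VS by rewrite -PQW addvSr.
have iso0 : totally_isotropic B 0%VS by rewrite /totally_isotropic sub0v.
have UWo X Y : (X <= U)%VS -> (Y <= W)%VS -> (X <= orthov B Y)%VS.
  move=> XU YW; apply/orthovP => x y xX yY; move/orthovP: UoW; apply.
    exact: (subvP XU).
  exact: (subvP YW).
have [||A [_ Asub Aiso dA]] := @extend_isotropic P1 Q2 0%VS k P1d Q2d (UWo _ _ P1U Q2W) iso0.
- by rewrite dimv0.
- by rewrite dP1 dQ2.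
have [|||C [_ Csub Ciso dC]] := @extend_isotropic P2 Q1 0%VS l P2d Q1d _ iso0.
- by rewrite orthov_sym UWo.
- by rewrite dimv0.
- by rewrite dP2 dQ1 minnC.
rewrite add0v in Asub; rewrite add0v in Csub.
have AC : (A <= orthov B C)%VS.
  have H : (P1 + Q2 <= orthov B (P2 + Q1))%VS.
    rewrite orthoDv !orthovD PQ1 (UWo P1 P2) //= (orthov_sym _ Q2 P2) PQ2 /=.
    by rewrite orthov_sym UWo.
  apply: subv_trans Asub _; apply: subv_trans H _.
  apply/subvP => x /mem_orthovP xo; apply/mem_orthovP => y /(subvP Csub); exact: xo.
have AC0 : (A :&: C = 0)%VS.
  apply/eqP/capv0P => x /(subvP Asub)/memv_addP[a aP [b bQ ->]].
  move=> /(subvP Csub)/memv_addP[c cP [d dQ']].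
  have WU := orth_decomp_sym UW.
  move=> abcd; have /esym := congr1 (daddv_pi U W) abcd; have := congr1 (daddv_pi W U) abcd.
  rewrite !linearD /=.
  rewrite (compl_pi_eq0 WU (subvP P1U _ aP)) (compl_pi_id WU (subvP Q2W _ bQ)) add0r.
  rewrite (compl_pi_id WU (subvP P2W _ cP)) (compl_pi_eq0 WU (subvP Q1U _ dQ')) addr0 => bc.
  rewrite (compl_pi_id UW (subvP P1U _ aP)) (compl_pi_eq0 UW (subvP Q2W _ bQ)) addr0.
  rewrite (compl_pi_eq0 UW (subvP P2W _ cP)) (compl_pi_id UW (subvP Q1U _ dQ')) add0r => da.
  have a0 : a = 0.
    by move/eqP/capv0P: (sdefinite_cap P1d Q1d); apply=> //; rewrite -da.
  have b0 : b = 0.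
    by move/eqP/capv0P: (sdefinite_cap P2d Q2d); apply=> //; rewrite bc.
  by rewrite a0 b0 addr0.
pose S0 := (A + C)%VS.
have S0iso : totally_isotropic B S0.
  rewrite /totally_isotropic orthoDv !orthovD.
  by rewrite (Aiso : (A <= orthov B A)%VS) AC orthov_sym AC (Ciso : (C <= orthov B C)%VS).
have [||S [S0S _ Siso dS]] := extend_isotropic Pd Qd PQ S0iso _ (_ : (r <= _)%N).
- by rewrite dimv_disjoint_sum // dA dC.
- by rewrite dP dQ.
exists S => //; split.
  rewrite -dA; apply: has_sdefiniteS (has_sdefinite_proj UW P1U Q2W P1d Q2d Aiso Asub).
  by apply: proj_toS; apply: subv_trans S0S; apply: addvSl.
rewrite -dC; rewrite addvC in Csub.
apply: has_sdefiniteS (has_sdefinite_proj UW Q1U P2W Q1d _ Ciso Csub); last by rewrite opprK.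
by apply: proj_toS; apply: subv_trans S0S; apply: addvSr.
Qed.

Lemma sdefinite_dim_leq X k l : has_sdefinite B 1 X k -> has_sdefinite B (-1) X l ->
  (k + l <= \dim X)%N.
Proof.
move=> [P [PX Pd <-]] [Q [QX Qd <-]].
by rewrite -dimv_disjoint_sum ?(sdefinite_cap Pd Qd) // dimvS // subv_add PX.
Qed.

Lemma sdefinite_radical0 X k l : has_sdefinite B 1 X k -> has_sdefinite B (-1) X l ->
  (\dim X <= k + l)%N -> radical B X = 0%VS.
Proof.
move=> [P [PX Pd dP]] [Q [QX Qd dQ]] dX.
have XE : (P + Q)%VS = X.
  apply/eqP; rewrite eqEdim subv_add PX QX.
  by rewrite dimv_disjoint_sum ?(sdefinite_cap Pd Qd) // dP dQ.
apply/eqP/radical0P => x; rewrite -XE => /memv_addP[a aP [b bQ ->]] abo.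
have := abo _ (subvP (addvSl P Q) _ aP); have := abo _ (subvP (addvSr P Q) _ bQ).
(* Orthogonality of [a + b] to [a] and to [b] gives [B a a = B b b], where the left side is
   nonnegative and the right side nonpositive. *)
rewrite !formDL (symformC B b a) => Eb Ea.
have Pd' x0 : x0 \in P -> 0 <= B x0 x0.
  by move=> xP; have [->|/(Pd _ xP)] := eqVneq x0 0; rewrite ?linear0l // mul1r => /ltW.
have Qd' x0 : x0 \in Q -> B x0 x0 <= 0.
  by move=> xP; have [->|/(Qd _ xP)] := eqVneq x0 0; rewrite ?linear0l // mulN1r oppr_gt0 => /ltW.
have := Pd' a aP; have := Qd' b bQ => Hb Ha.
have aa0 : B a a = 0 by lra.
have bb0 : B b b = 0 by lra.
by rewrite (sdefinite_isotropic Pd aP aa0) (sdefinite_isotropic Qd bQ bb0) addr0.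
Qed.

End IsotropicSubspaces.

(** * Increasing the index by hyperbolic rotations *)

Section Perturbation.
Variables (R : realType) (V : vectType R) (B : {symmetric V}).
Implicit Types (U W X Y Z P Q T S : {vspace V}) (x y z e s u : V) (eps : R).

(** If [e] is orthogonal to [u], then [u' + t e] still pairs with [u] as [u'] does, and it has the
    sign of [e] for large [t]. *)
Lemma exists_sdefinite_direction eps X e u u' : eps * eps = 1 ->
  e \in X -> 0 < eps * B e e -> u' \in X -> B u u' != 0 ->
  exists e', [/\ e' \in X, B e' e' = eps & B u e' != 0].
Proof.
move=> ee eX ep u'X uu'.
suff [e' [e'X e'p ue']] : exists e', [/\ e' \in X, 0 < eps * B e' e' & B u e' != 0].
  have [t t0 tE] := normalize_vector ee e'p.
  by exists (t *: e'); split; rewrite ?memvZ // formZR mulf_neq0.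
have [ue | ue] := eqVneq (B u e) 0; last by exists e.
pose a := eps * B e e; pose b := eps * B e u'; pose c := eps * B u' u'.
(* Chosen so that [1 <= t] and [t * a = a + 2 |b| + |c| + 1], which makes [t (t a + 2 b) + c]
   positive. *)
pose t := 1 + (2 * `|b| + `|c| + 1) / a.
have t1 : 1 <= t.
  by rewrite lerDl divr_ge0 ?ltW // !addr_ge0 ?mulr_ge0 ?normr_ge0.
exists (u' + t *: e); split; first by rewrite memvD ?memvZ.
  rewrite !formE (symformC B u' e).
  have -> : eps * (B u' u' + t * B e u' + (t * B e u' + t * (t * B e e))) =
      t * (t * a + 2 * b) + c by rewrite /a /b /c; ring.
  have ta : t * a = a + (2 * `|b| + `|c| + 1).
    by rewrite /t mulrDl mul1r divfK // gt_eqF.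
  have nb : - `|b| <= b by rewrite lerNl ler_normr lexx orbT.
  have nc : - `|c| <= c by rewrite lerNl ler_normr lexx orbT.
  have h : `|c| + 1 <= t * a + 2 * b by rewrite ta; have : 0 < a by []; lra.
  have h2 : `|c| + 1 <= t * (t * a + 2 * b).
    by apply: le_trans (h) _; rewrite ler_peMl //; apply: le_trans h; rewrite addr_ge0.
  by lra.
by rewrite formDR formZR ue mulr0 addr0.
Qed.

(* With [al = B u e] and [be = - B w f], the number [al + ka] is the coordinate along [e]
   of the image under the hyperbolic rotation of parameter [c]. *)
Lemma hyperbolic_growth (al be c : R) : 0 <= al * be -> al != 0 \/ be != 0 -> 1 < c ->
  forall ka, ka = 2^-1 * ((c - 1) * (al + be) + (c^-1 - 1) * (al - be)) ->
  0 < 2 * ka * al + ka * ka.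
Proof.
move=> ab ab0 c1 ka kaE.
have c0 : 0 < c by lra.
have s0 : 0 < (al + be) ^+ 2.
  rewrite exprn_even_gt0 //= addr_eq0; apply/eqP => abE; move: ab.
  rewrite abE mulNr oppr_ge0 -expr2 => be2.
  have : be == 0 by rewrite -sqrf_eq0 eq_le be2 sqr_ge0.
  by move=> /eqP be0; move: abE; rewrite be0 oppr0 => al0; case: ab0; rewrite ?al0 ?be0 eqxx.
have sd : (al - be) ^+ 2 <= (al + be) ^+ 2 by rewrite -subr_ge0 (_ : _ - _ = 4 * (al * be)); [lra | ring].
have -> : 2 * ka * al + ka * ka =
    4^-1 * (c ^+ 2 - 1) * ((al + be) ^+ 2 - (al - be) ^+ 2 / c ^+ 2).
  by rewrite kaE; field; rewrite gt_eqF.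
have c2 : 1 < c ^+ 2 by rewrite expr2; nra.
rewrite mulr_gt0 //; first by rewrite mulr_gt0 //; lra.
rewrite subr_gt0 ltr_pdivrMr ?exprn_gt0 //.
by apply: le_lt_trans sd _; rewrite ltr_pMr.
Qed.

(** The form induced on [S] by the projection to [U] has rank below [\dim S]: either the projection
    has a kernel on [S], or its image has a radical. *)
Lemma degenerate_vector U W S : orth_decomp B U W ->
  (pos_index B (proj_to U W S) + neg_index B (proj_to U W S) < \dim S)%N ->
  exists s, [/\ s \in S, s != 0 &
    {in S, forall t, B (daddv_pi U W s) (daddv_pi U W t) = 0}].
Proof.
move=> UW hS; have WU := orth_decomp_sym UW.
have [SW | SW] := eqVneq (S :&: W)%VS 0%VS; last first.
  have /memv_capP[sS sW] := memv_pick (S :&: W)%VS.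
  exists (vpick (S :&: W)%VS); split; rewrite ?vpick0 // => t tS.
  by rewrite (compl_pi_eq0 UW sW) linear0l.
have [r0 | r0] := eqVneq (radical B (proj_to U W S)) 0%VS.
  have [P [Q [Pd Qd PQ PQE [dP dQ]]]] := signature_decomposition (And3 r0 erefl erefl).
  move: hS; rewrite -(dim_proj_to UW S) SW dimv0 addn0 -{3}PQE.
  by rewrite dimv_disjoint_sum ?(sdefinite_cap Pd Qd) // dP dQ ltnn.
have /radicalP[/(proj_toP UW)[s sS sE] xr] := memv_pick (radical B (proj_to U W S)).
exists s; split=> // [|t tS].
  by apply: contraNneq r0 => s0; move: sE; rewrite s0 linear0 => /eqP; rewrite vpick0.
by rewrite -sE xr // (mem_proj_to UW).
Qed.

Lemma exists_sdefinite_orthov eps U P k : eps * eps = 1 -> sdefinite B eps P ->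
  has_sdefinite B eps U k -> (\dim P < k)%N ->
  exists2 e, e \in (U :&: orthov B P)%VS & B e e = eps.
Proof.
move=> ee Pd [Q [QU Qd dQ]] kP; apply: (has_sdefinite_unit ee).
apply: (@has_sdefiniteS _ _ _ _ (Q :&: orthov B P)%VS); first exact: capvS.
apply: has_sdefinite_dim_pos; first exact: sdefiniteS (capvSl _ _) Qd.
have := dim_cap_orthov B Q P; lia.
Qed.

Lemma dim_limg_leq (f : 'End(V)) X : (\dim (f @: X) <= \dim X)%N.
Proof. by rewrite -(limg_ker_dim f X) leq_addl. Qed.

Lemma exists_orthov_dual eps U P u : radical B U = 0%VS -> (P <= U)%VS ->
  sdefinite B eps P -> u \in (U :&: orthov B P)%VS -> u != 0 ->
  exists2 u', u' \in (U :&: orthov B P)%VS & B u u' != 0.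
Proof.
move=> /eqP/radical0P U0 PU Pd /memv_capP[uU /mem_orthovP uP] u0.
have [//|H] := pselect (exists2 u', u' \in (U :&: orthov B P)%VS & B u u' != 0).
case/eqP: u0; apply: U0 => // y.
rewrite -(addv_cap_orthov PU (sdefinite_cap_orthov Pd)) => /memv_addP[a aP [b bT ->]].
rewrite formDR uP // add0r; apply/eqP/negPn/negP => ub; apply: H; by exists b.
Qed.

(** The pair [n], [m] is fixed before [c], so that [c] may later be taken arbitrarily close to 1. *)
Lemma isotropic_perturbation U W S (p1 q2 : nat) : orth_decomp B U W ->
  radical B U = 0%VS -> radical B W = 0%VS ->
  has_sdefinite B 1 U p1 -> has_sdefinite B (-1) W q2 ->
  totally_isotropic B S ->
  (pos_index B (proj_to U W S) + neg_index B (proj_to U W S) < \dim S)%N ->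
  (pos_index B (proj_to U W S) < minn p1 q2)%N ->
  exists n m, [/\ B n n = 0, B m m = 0, B n m = 1 &
    forall (c : R) (g : 'End(V)), 1 < c ->
      (forall z, g z = z + ((c - 1) * B z m) *: n + ((c^-1 - 1) * B z n) *: m) ->
      has_sdefinite B 1 (proj_to U W (g @: S)) (pos_index B (proj_to U W S)).+1].
Proof.
move=> UW U0 W0 Up Wq Siso hS; rewrite leq_min => /andP[kp kq].
have WU := orth_decomp_sym UW; have [_ _ /orthovP UoW] := UW.
set pU := daddv_pi U W; set pW := daddv_pi W U.
set k := pos_index _ _ in kp kq *.
have [P [PS Pd dP]] := (leq_pos_index B (proj_to U W S) k).1 (leqnn _).
have PU : (P <= U)%VS by apply: subv_trans PS (capvSr _ _).
have [l lP] := linear_section pU S.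
have lS x : x \in P -> l x \in S /\ pU (l x) = x.
  by move=> /(subvP PS); rewrite (proj_toE UW) => /lP.
(* The [W]-components of the lift of [P]. A rotation in a plane orthogonal to both [P] and [Q] fixes
   this lift, so [P] survives in the new projection. *)
pose Q := (pW @: (l @: P))%VS.
have QW : (Q <= W)%VS by apply/subvP => _ /memv_imgP[x _ ->]; apply: memv_pi.
have Qd : sdefinite B (-1) Q.
  move=> _ /memv_imgP[_ /memv_imgP[x xP ->] ->] w0.
  have [lx lxE] := lS x xP.
  rewrite (isotropic_pi UW Siso) // lxE mulrNN; apply: Pd => //.
  by apply: contraNneq w0 => ->; rewrite !linear0.
have dQ : (\dim Q <= k)%N by rewrite -dP (leq_trans (dim_limg_leq _ _)) ?dim_limg_leq.
have [s [sS s0 sr]] := degenerate_vector UW hS.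
pose u := pU s; pose w := pW s.
have uw : s = u + w by rewrite (compl_pi_add UW).
have uT : u \in (U :&: orthov B P)%VS.
  rewrite memv_cap memv_pi; apply/mem_orthovP => y yP.
  by have [l1 {1}<-] := lS y yP; apply: sr.
have wT : w \in (W :&: orthov B Q)%VS.
  rewrite memv_cap memv_pi; apply/mem_orthovP => _ /memv_imgP[_ /memv_imgP[x xP ->] ->].
  have [l1 l2] := lS x xP.
  by rewrite (isotropic_pi UW Siso) // sr // oppr0.
have uu : B u u = 0 by apply: sr.
have e11 : (1 : R) * 1 = 1 by rewrite mulr1.
have eN1 : (-1 : R) * -1 = 1 by rewrite mulrNN mulr1.
have [|e0 e0T e0B] := exists_sdefinite_orthov e11 Pd Up; first by rewrite dP.
have [|f0 f0T f0B] := exists_sdefinite_orthov eN1 Qd Wq; first exact: leq_ltn_trans kq.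
have [e [f [eT fT ee ff abn0]]] : exists e f, [/\ e \in (U :&: orthov B P)%VS,
    f \in (W :&: orthov B Q)%VS, B e e = 1, B f f = -1 & B u e != 0 \/ B w f != 0].
  have [u0 | u0] := eqVneq u 0.
    have w0 : w != 0 by apply: contraNneq s0 => w0; rewrite uw u0 w0 addr0.
    have [w' w'T ww'] := exists_orthov_dual W0 QW Qd wT w0.
    have [|f [fT ff wf]] := exists_sdefinite_direction eN1 f0T _ w'T ww'.
      by rewrite f0B eN1.
    by exists e0, f; split=> //; right.
  have [u' u'T uu'] := exists_orthov_dual U0 PU Pd uT u0.
  have [|e [eT ee ue]] := exists_sdefinite_direction e11 e0T _ u'T uu'.
    by rewrite e0B e11.
  by exists e, f0; split=> //; left.
(* The sign of [f] is adjusted to the hypothesis of [hyperbolic_growth]: with the wrong sign, a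
   small rotation with [c > 1] could decrease the norm. *)
have {f fT ff abn0} [f [fT ff abn0 absign]] : exists f, [/\ f \in (W :&: orthov B Q)%VS,
    B f f = -1, B u e != 0 \/ - B w f != 0 & 0 <= B u e * - B w f].
  have [ge | lt] := leP 0 (B u e * - B w f).
    by exists f; split; rewrite ?oppr_eq0.
  exists (- f); split; rewrite ?memvN ?formNL ?formNR ?opprK //.
  by move: lt; rewrite mulrN oppr_lt0 => /ltW.
have [eU /mem_orthovP eP] := memv_capP eT; have [fW /mem_orthovP fQ] := memv_capP fT.
have ef : B e f = 0 by apply: UoW.
have fe : B f e = 0 by rewrite symformC.
(* The isotropic directions of the plane [<e, f>], normalized to pair to 1. Scaling them by [c] and
   [c^-1] is the hyperbolic rotation. *)
exists (e + f), (2^-1 *: (e - f)); split; try by rewrite !formE ee ff ef fe; field.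
move=> c g c1 gE.
have formUe z : B z e = B (pU z) e.
  rewrite (form_pi UW) (compl_pi_id UW eU) (compl_pi_eq0 WU eU).
  by rewrite linear0r addr0.
have formWf z : B z f = B (pW z) f.
  by rewrite (form_pi UW) (compl_pi_id WU fW) (compl_pi_eq0 UW fW) linear0r add0r.
have gfix x : x \in P -> g (l x) = l x.
  move=> xP; have [l1 l2] := lS x xP.
  have xe : B (l x) e = 0 by rewrite formUe l2 symformC eP.
  have xf : B (l x) f = 0 by rewrite formWf symformC fQ // !memv_img.
  by rewrite gE !formE xe xf oppr0 addr0 !mulr0 !scale0r !addr0.
pose ka := 2^-1 * ((c - 1) * (B u e + - B w f) + (c^-1 - 1) * (B u e - - B w f)).
have gsE : pU (g s) = u + ka *: e.
  have nE : pU (e + f) = e.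
    by rewrite linearD /= (compl_pi_id UW eU) (compl_pi_eq0 UW fW) addr0.
  have mE : pU (2^-1 *: (e - f)) = 2^-1 *: e.
    by rewrite linearZ linearB /= (compl_pi_id UW eU) (compl_pi_eq0 UW fW) subr0.
  have pUE a b x y z : pU (x + a *: y + b *: z) = pU x + a *: pU y + b *: pU z.
    by rewrite !linearD !linearZ.
  rewrite gE pUE nE mE -/u -addrA scalerA -scalerDl; congr (_ + _ *: _).
  by rewrite !formE formUe formWf -/u -/w /ka; field; rewrite gt_eqF // (lt_trans ltr01).
have Pe x : x \in P -> B x e = 0 by move=> xP; rewrite symformC eP.
have Pu x : x \in P -> B x u = 0.
  move: uT => /memv_capP[_ /mem_orthovP uP] xP; by rewrite symformC uP.
have Pv : {in P, forall x, B x (u + ka *: e) = 0}.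
  by move=> x xP; rewrite formDR formZR Pe // Pu // mulr0 addr0.
have vv : 0 < 1 * B (u + ka *: e) (u + ka *: e).
  have := hyperbolic_growth absign abn0 c1 (erefl ka).
  rewrite !formE uu ee (symformC B e u) mul1r => H.
  by rewrite (_ : _ + _ = 2 * ka * B u e + ka * ka) //; ring.
exists (P + <[(u + ka *: e)%R]>)%VS; split; last by rewrite (dim_add_line Pd vv Pv) dP.
  rewrite subv_add -memvE -gsE (mem_proj_to UW) ?memv_img // andbT.
  apply/subvP => x xP; have [l1 {1}<-] := lS x xP.
  by rewrite -gfix // (mem_proj_to UW) ?memv_img.
exact: sdefinite_add_line.
Qed.

End Perturbation.

(** * Orbits with maximal indices *)

Section GenericOrbits.
Variables (R : realType) (V : vectType R) (B : {symmetric V}).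
Implicit Types (U W X Y Z P Q T S : {vspace V}) (x y z e s u : V) (eps : R).
Implicit Types (g : 'End(V)) (r k l : nat).

Lemma has_sdefinite_index eps X Y k : pos_index B X = pos_index B Y ->
  neg_index B X = neg_index B Y -> eps * eps = 1 ->
  has_sdefinite B eps X k <-> has_sdefinite B eps Y k.
Proof.
move=> hp hn ee.
have /eqP : (eps - 1) * (eps + 1) = 0 by ring: ee.
rewrite mulf_eq0 subr_eq0 addr_eq0 => /orP[] /eqP ->.
  by rewrite -!leq_pos_index hp.
by rewrite -!leq_neg_index hn.
Qed.

(** This exchanges the roles of [b_U] and [b_W], so that statements about one follow from statements
    about the other. *)
Lemma pos_index_proj_swap U W S : orth_decomp B U W -> totally_isotropic B S ->
  pos_index B (proj_to W U S) = neg_index B (proj_to U W S).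
Proof.
move=> UW Siso; have WU := orth_decomp_sym UW.
apply/eqP; rewrite eqn_leq; apply/andP; split.
  apply/leq_neg_index; apply: (has_sdefinite_proj_swap WU Siso).
  exact/leq_pos_index.
apply/leq_pos_index; rewrite -(opprK (1 : R)); apply: (has_sdefinite_proj_swap UW Siso).
exact/leq_neg_index.
Qed.

Lemma isometry_of_eq0 X g x : radical B X = 0%VS -> isometry_of B X g ->
  x \in X -> g x = 0 -> x = 0.
Proof.
move=> /eqP/radical0P X0 [_ gB] xX gx0; apply: X0 => // y yX.
by rewrite -gB // gx0 linear0l.
Qed.

Lemma isometry_has_sdefinite eps X Y g k : isometry_of B X g -> (Y <= X)%VS ->
  has_sdefinite B eps (g @: Y) k <-> has_sdefinite B eps Y k.
Proof.
move=> [_ gB] /subvP YX; split=> -[P [PY Pd <-]].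
  have [l lP] := linear_section g Y.
  have lY x : x \in P -> l x \in Y /\ g (l x) = x by move=> /(subvP PY)/lP.
  have lB x : x \in P -> B (l x) (l x) = B x x.
    by move=> /lY[lx {3 4}<-]; rewrite gB ?YX.
  exists (l @: P)%VS; split.
  - by apply/subvP => _ /memv_imgP[x /lY[lx _] ->].
  - move=> _ /memv_imgP[x xP ->] lx0; rewrite lB // Pd //.
    by apply: contraNneq lx0 => ->; rewrite linear0.
  - apply: limg_dim_eq; apply/eqP/capv0P => x xP; rewrite memv_ker => /eqP lx0.
    by have [_ <-] := lY x xP; rewrite lx0 linear0.
have YP x : x \in P -> x \in X by move=> /(subvP PY)/YX.
exists (g @: P)%VS; split; first exact: limgS.
- move=> _ /memv_imgP[x xP ->] gx0; rewrite gB ?YP // Pd //.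
  by apply: contraNneq gx0 => ->; rewrite linear0.
- apply: limg_dim_eq; apply/eqP/capv0P => x xP; rewrite memv_ker => /eqP gx0.
  by apply: (sdefinite_isotropic Pd xP); rewrite -gB ?YP // gx0 linear0l.
Qed.

Section Fixed.
Variables (U W : {vspace V}).
Hypotheses (UW : orth_decomp B U W) (U0 : radical B U = 0%VS) (W0 : radical B W = 0%VS).
Let WU := orth_decomp_sym UW.

Lemma proj_to_isometry g S : isometry_prod B U W g ->
  proj_to U W (g @: S) = (g @: proj_to U W S)%VS.
Proof.
move=> [gU gW]; rewrite !(proj_toE UW) -!limg_comp; apply: eq_in_limg => s _.
rewrite !comp_lfunE -{1}(compl_pi_add UW s) !linearD /=.
rewrite (compl_pi_id UW (isometry_of_mem gU (memv_pi _ _ _))).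
by rewrite (compl_pi_eq0 UW (isometry_of_mem gW (memv_pi _ _ _))) addr0.
Qed.

Lemma isometry_prod_index g S : isometry_prod B U W g ->
  pos_index B (proj_to U W (g @: S)) = pos_index B (proj_to U W S) /\
  neg_index B (proj_to U W (g @: S)) = neg_index B (proj_to U W S).
Proof.
move=> gI; have [gU _] := gI; rewrite proj_to_isometry //.
have H eps k := isometry_has_sdefinite eps k gU (capvSr (S + W) U).
split; apply/eqP; rewrite eqn_leq; apply/andP; split.
- by apply/leq_pos_index/H/leq_pos_index.
- by apply/leq_pos_index/H/leq_pos_index.
- by apply/leq_neg_index/H/leq_neg_index.
- by apply/leq_neg_index/H/leq_neg_index.
Qed.

Lemma isometry_prod_eq0 g x : isometry_prod B U W g -> g x = 0 -> x = 0.
Proof.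
move=> [gU gW]; rewrite -(compl_pi_add UW x) linearD /= => gx0.
have gpU := isometry_of_mem gU (memv_pi U W x).
have gpW := isometry_of_mem gW (memv_pi W U x).
have gUE : g (daddv_pi U W x) = 0.
  by rewrite -(compl_pi_id UW gpU) -[X in daddv_pi _ _ X](addrK (g (daddv_pi W U x)))
     gx0 sub0r linearN /= (compl_pi_eq0 UW gpW) oppr0.
have gWE : g (daddv_pi W U x) = 0 by rewrite -[LHS]add0r -{1}gUE.
by rewrite (isometry_of_eq0 U0 gU (memv_pi _ _ _) gUE)
           (isometry_of_eq0 W0 gW (memv_pi _ _ _) gWE) addr0.
Qed.

Lemma isometry_prod_form g x y : isometry_prod B U W g -> B (g x) (g y) = B x y.
Proof.
move=> [gU gW].
have gE z : g z = g (daddv_pi U W z) + g (daddv_pi W U z).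
  by rewrite -linearD (compl_pi_add UW).
have gpU z := isometry_of_mem gU (memv_pi U W z).
have gpW z := isometry_of_mem gW (memv_pi W U z).
have pgU z : daddv_pi U W (g z) = g (daddv_pi U W z).
  by rewrite gE linearD /= (compl_pi_id UW (gpU z)) (compl_pi_eq0 UW (gpW z)) addr0.
have pgW z : daddv_pi W U (g z) = g (daddv_pi W U z).
  by rewrite gE linearD /= (compl_pi_id WU (gpW z)) (compl_pi_eq0 WU (gpU z)) add0r.
rewrite (form_pi UW (g x)) !pgU !pgW gU.2 ?memv_pi // gW.2 ?memv_pi //.
by rewrite -(form_pi UW).
Qed.

Lemma isoGr_isometry g r S : (forall x y, B (g x) (g y) = B x y) ->
  (forall x, g x = 0 -> x = 0) -> isoGr B r S -> isoGr B r (g @: S)%VS.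
Proof.
move=> gB g0 [<- /orthovP Siso]; split.
  by apply: limg_dim_eq; apply/eqP/capv0P => x _; rewrite memv_ker => /eqP /g0.
by apply/orthovP => _ _ /memv_imgP[x xS ->] /memv_imgP[y yS ->]; rewrite gB Siso.
Qed.

(** Lower bounds rather than equalities, so that semicontinuity makes the set open. When [k + l] is
    as large as possible, equality is automatic. *)
Definition generic_set r k l : set {vspace V} :=
  [set S | [/\ isoGr B r S, (k <= pos_index B (proj_to U W S))%N
                          & (l <= neg_index B (proj_to U W S))%N]].

Lemma generic_set_isometry r k l g S : isometry_prod B U W g ->
  generic_set r k l S -> generic_set r k l (g @: S)%VS.
Proof.
move=> gI [Siso kS lS]; have [pE nE] := isometry_prod_index S gI.
split; rewrite ?pE ?nE //; apply: isoGr_isometry Siso => x; last exact: isometry_prod_eq0.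
by move=> y; apply: isometry_prod_form.
Qed.

Lemma index_sum_leq X : (pos_index B X + neg_index B X <= \dim X)%N.
Proof. by apply: sdefinite_dim_leq; [apply/leq_pos_index | apply/leq_neg_index]. Qed.

(** [\dim S] is the sum of the dimensions of the projection to [U] and of [S :&: W], and the
    definite parts already account for all of it. *)
Lemma generic_set_full r k l S : (k + l = r)%N -> generic_set r k l S ->
  [/\ (S :&: U = 0)%VS, (S :&: W = 0)%VS, radical B (proj_to U W S) = 0%VS,
      pos_index B (proj_to U W S) = k & neg_index B (proj_to U W S) = l].
Proof.
move=> klr [[dS Siso] kS lS].
have dP := dim_proj_to UW S; have iP := index_sum_leq (proj_to U W S).
have SW : (S :&: W = 0)%VS by apply/eqP; rewrite -dimv_eq0; lia.
have r0 : radical B (proj_to U W S) = 0%VS.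
  apply: (@sdefinite_radical0 _ _ _ _ k l); [exact/leq_pos_index | exact/leq_neg_index | lia].
split=> //; [|lia|lia].
apply/eqP; rewrite -subv0 -r0; case: UW => _ _ UoW.
exact: cap_sub_radical_proj.
Qed.

End Fixed.

Lemma generic_set_swap U W r k l S : orth_decomp B U W ->
  generic_set U W r k l S -> generic_set W U r l k S.
Proof.
move=> UW [SG kS lS]; have Siso := SG.2; have WU := orth_decomp_sym UW.
by split=> //; rewrite ?(pos_index_proj_swap UW) // -(pos_index_proj_swap WU).
Qed.

(** The definite parts fill [W], so the projection to [W] is all of [W] and nondegenerate. The facts
    about [U] follow by exchanging the factors. *)
Lemma generic_set_dimW U W r k l S : orth_decomp B U W -> (k + l = \dim W)%N ->
  generic_set U W r k l S ->
  [/\ (S :&: W = 0)%VS, (radical B (proj_to U W S) <= S)%VS,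
      \dim (S :&: U) = (r - k - l)%N,
      pos_index B (proj_to U W S) = k & neg_index B (proj_to U W S) = l].
Proof.
move=> UW klW SE; have WU := orth_decomp_sym UW.
have [[dS Siso] lS kS] := generic_set_swap UW SE.
have dP := dim_proj_to WU S; have iP := index_sum_leq (proj_to W U S).
have dPW : (\dim (proj_to W U S) <= \dim W)%N by rewrite dimvS ?capvSr.
have r0 : radical B (proj_to W U S) = 0%VS.
  apply: (@sdefinite_radical0 _ _ _ _ l k); [exact/leq_pos_index | exact/leq_neg_index | lia].
split.
- apply/eqP; rewrite -subv0 -r0; case: WU => _ _ WoU.
  exact: cap_sub_radical_proj.
- by apply: (radical_proj_swap WU) => //; rewrite r0 sub0v.
- lia.
- by rewrite (pos_index_proj_swap WU) //; lia.
- by rewrite -(pos_index_proj_swap UW) //; lia.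
Qed.

Lemma generic_set_transitive U W r k l S S' : orth_decomp B U W ->
  radical B U = 0%VS -> radical B W = 0%VS ->
  [\/ k + l = r, k + l = \dim W | k + l = \dim U]%N ->
  generic_set U W r k l S -> generic_set U W r k l S' ->
  exists2 g, isometry_prod B U W g & (g @: S)%VS = S'.
Proof.
move=> UW U0 W0 hkl SE S'E; have WU := orth_decomp_sym UW.
have [[dS Siso] _ _] := SE; have [[dS' S'iso] _ _] := S'E.
have dSS' : \dim S = \dim S' by rewrite dS.
case: hkl => hkl.
- have [_ SW r0 pS nS] := generic_set_full UW hkl SE.
  have [_ S'W r'0 pS' nS'] := generic_set_full UW hkl S'E.
  apply: (isometry_prod_transitive UW) => //; rewrite ?r0 ?r'0 ?sub0v //.
  by move=> eps j; apply: has_sdefinite_index; rewrite ?pS ?pS' ?nS ?nS'.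
- have [SW r0 _ pS nS] := generic_set_dimW UW hkl SE.
  have [S'W r'0 _ pS' nS'] := generic_set_dimW UW hkl S'E.
  apply: (isometry_prod_transitive UW) => //.
  by move=> eps j; apply: has_sdefinite_index; rewrite ?pS ?pS' ?nS ?nS'.
- rewrite addnC in hkl.
  have [SU r0 _ pS nS] := generic_set_dimW WU hkl (generic_set_swap UW SE).
  have [S'U r'0 _ pS' nS'] := generic_set_dimW WU hkl (generic_set_swap UW S'E).
  have [|g [gW gU] gS] := isometry_prod_transitive WU W0 U0 Siso S'iso dSS' SU S'U r0 r'0.
    by move=> eps j; apply: has_sdefinite_index; rewrite ?pS ?pS' ?nS ?nS'.
  by exists g.
Qed.

Lemma generic_set_orbit U W r k l S : orth_decomp B U W ->
  radical B U = 0%VS -> radical B W = 0%VS ->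
  [\/ k + l = r, k + l = \dim W | k + l = \dim U]%N ->
  generic_set U W r k l S ->
  generic_set U W r k l = [set (g @: S)%VS | g in isometry_prod B U W].
Proof.
move=> UW U0 W0 hkl SE; apply/seteqP; split=> [S' S'E | _ [g gI <-]].
  by have [g gI gS] := generic_set_transitive UW U0 W0 hkl SE S'E; exists g.
exact: generic_set_isometry.
Qed.

Lemma generic_set_O_full U W r k l : orth_decomp B U W -> (k + l = r)%N ->
  generic_set U W r k l = O_ B U W r 0 0 0 k l.
Proof.
move=> UW hkl; apply/seteqP; split=> S.
  move=> SE; have [SU SW r0 pS nS] := generic_set_full UW hkl SE.
  by case: SE => SG _ _; split=> //; split=> //; rewrite ?SU ?SW ?/inv_a ?r0 ?SU ?dimv0.
by move=> [SG [_ _ _ pS nS]]; split; rewrite ?pS ?nS.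
Qed.

Lemma generic_set_O_dimW U W r k l : orth_decomp B U W -> (k + l = \dim W)%N ->
  generic_set U W r k l = O_ B U W r (r - k - l) 0 0 k l.
Proof.
move=> UW hkl; apply/seteqP; split=> S.
  move=> SE; have [SW rS dSU pS nS] := generic_set_dimW UW hkl SE.
  case: SE => SG _ _; split=> //; split=> //; first by rewrite SW dimv0.
  (* [inv_a] is a truncated difference, so it vanishes as soon as the radical lies in [S :&: U]. *)
  apply/eqP; rewrite subn_eq0 dimvS // subv_cap rS.
  by apply: subv_trans (capvSl _ _) (capvSr _ _).
by move=> [SG [_ _ _ pS nS]]; split; rewrite ?pS ?nS.
Qed.

Lemma generic_set_O_dimU U W r k l : orth_decomp B U W -> (k + l = \dim U)%N ->
  generic_set U W r k l = O_ B U W r 0 (r - k - l) 0 k l.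
Proof.
move=> UW hkl; apply/seteqP; split=> S.
  move=> SE; have hlk : (l + k = \dim U)%N by rewrite addnC.
  have [SU _ dSW _ _] := generic_set_dimW (orth_decomp_sym UW) hlk (generic_set_swap UW SE).
  case: SE => SG kS lS.
  have iP := index_sum_leq (proj_to U W S).
  have dPU : (\dim (proj_to U W S) <= \dim U)%N by rewrite dimvS ?capvSr.
  have r0 : radical B (proj_to U W S) = 0%VS.
    by apply: (@sdefinite_radical0 _ _ _ _ k l); [exact/leq_pos_index | exact/leq_neg_index | lia].
  split=> //; split; rewrite ?SU ?dimv0 // ?/inv_a ?r0 ?dimv0 ?dSW; lia.
by move=> [SG [_ _ _ pS nS]]; split; rewrite ?pS ?nS.
Qed.

End GenericOrbits.

(** * Semicontinuity of the indices *)

Section MatrixLimits.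
Variables (R : realType).

Lemma cvg_mulmx (T : Type) (F : set_system T) (FF : Filter F) m n p
    (G : T -> 'M[R]_(m, n)) (H : T -> 'M[R]_(n, p))
    (A : 'M[R]_(m, n)) (C : 'M[R]_(n, p)) :
  (forall i j, G x i j @[x --> F] --> A i j) ->
  (forall i j, H x i j @[x --> F] --> C i j) ->
  forall i j, (G x *m H x) i j @[x --> F] --> (A *m C) i j.
Proof.
move=> GA HC i j; rewrite mxE.
under eq_cvg do rewrite mxE.
apply: (cvg_big (op := +%R)) => [|k _]; first exact: add_continuous.
exact: cvgM.
Qed.

Lemma near_mx (T : Type) (F : set_system T) (FF : Filter F) m n
    (G : T -> 'M[R]_(m, n)) (A : 'M[R]_(m, n)) (E : set 'M[R]_(m, n)) :
  (forall i j, G x i j @[x --> F] --> A i j) -> nbhs A E -> \forall x \near F, E (G x).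
Proof.
move=> GA [P AP PE].
have H : \forall x \near F, forall i, forall j, P i j (G x i j).
  apply: filter_forall => i; apply: filter_forall => j.
  exact: (GA i j _ (AP i j)).
by apply: filterS H => x Hx; apply: PE.
Qed.

Lemma quad_formE k (M : 'M[R]_k) (c : 'rV[R]_k) :
  (c *m M *m c^T) 0 0 = \sum_i \sum_j c 0 i * M i j * c 0 j.
Proof.
rewrite mxE exchange_big; apply: eq_bigr => j _.
by rewrite !mxE mulr_suml.
Qed.

Lemma sum_sqr_gt0 k (c : 'rV[R]_k) : c != 0 -> 0 < \sum_i c 0 i ^+ 2.
Proof.
move=> c0; rewrite lt_neqAle sumr_ge0 ?andbT => [|i _]; last exact: sqr_ge0.
apply: contra_neq c0 => /esym/eqP; rewrite psumr_eq0 => [/allP H|i _]; last exact: sqr_ge0.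
by apply/rowP => i; rewrite mxE; apply/eqP; rewrite -sqrf_eq0; apply: (H i); rewrite mem_index_enum.
Qed.

(** With [d = 1 / (k + 1)], the error [c N c^T] is at most [d / 2] times the double sum of
    [c_i^2 + c_j^2], that is [k d] times the sum of squares, and [k d < 1]. *)
Lemma near1_posdef k (M : 'M[R]_k) :
  (forall i j, `|M i j - (1%:M : 'M[R]_k) i j| < k.+1%:R^-1) ->
  forall c : 'rV[R]_k, c != 0 -> 0 < (c *m M *m c^T) 0 0.
Proof.
move=> HM c c0; pose d : R := k.+1%:R^-1; pose s := \sum_i c 0 i ^+ 2.
have s0 : 0 < s by apply: sum_sqr_gt0.
pose N := M - 1%:M.
have -> : c *m M *m c^T = c *m N *m c^T + c *m c^T.
  by rewrite /N mulmxBr mulmxBl mulmx1 subrK.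
rewrite mxE [X in _ + X](_ : _ = s); last first.
  by rewrite mxE; apply: eq_bigr => i _; rewrite mxE expr2.
rewrite quad_formE.
have H i j : 0 <= c 0 i * N i j * c 0 j + d / 2 * (c 0 i ^+ 2 + c 0 j ^+ 2).
  have := HM i j; rewrite -/d => /ltW; have -> : M i j - 1%:M i j = N i j by rewrite !mxE.
  rewrite ler_norml => /andP[N1 N2].
  have S1 := sqr_ge0 (c 0 i + c 0 j); have S2 := sqr_ge0 (c 0 i - c 0 j).
  have d0 : 0 < d by rewrite /d invr_gt0 ltr0n.
  move: (c 0 i) (c 0 j) (N i j) N1 N2 S1 S2 => a b t N1 N2 S1 S2.
  have -> : a * t * b + d / 2 * (a ^+ 2 + b ^+ 2) =
     4^-1 * ((d + t) * (a + b) ^+ 2 + (d - t) * (a - b) ^+ 2) by field.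
  by rewrite mulr_ge0 ?invr_ge0 // addr_ge0 // mulr_ge0 //; lra.
have dsum : \sum_i \sum_j (c 0 i ^+ 2 + c 0 j ^+ 2) = 2 * k%:R * s.
  transitivity (\sum_(i < k) (k%:R * c 0 i ^+ 2 + s)).
    by apply: eq_bigr => i _; rewrite big_split /= sumr_const card_ord mulr_natl.
  by rewrite big_split /= -mulr_sumr sumr_const card_ord -/s -mulr_natl; ring.
have : 0 <= \sum_i \sum_j (c 0 i * N i j * c 0 j + d / 2 * (c 0 i ^+ 2 + c 0 j ^+ 2)).
  by apply: sumr_ge0 => i _; apply: sumr_ge0 => j _; apply: H.
have -> : \sum_i \sum_j (c 0 i * N i j * c 0 j + d / 2 * (c 0 i ^+ 2 + c 0 j ^+ 2)) =
    \sum_i \sum_j c 0 i * N i j * c 0 j + d / 2 * (2 * k%:R * s).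
  rewrite -dsum mulr_sumr -big_split; apply: eq_bigr => i _.
  by rewrite mulr_sumr -big_split.
set q := \sum_i _ => q0.
have kd : k%:R * d < 1.
  by rewrite /d ltr_pdivrMr ?ltr0n // mul1r ltr_nat.
by nra.
Qed.

Lemma near_posdef (T : Type) (F : set_system T) (FF : Filter F) k (G : T -> 'M[R]_k) :
  (forall i j, G x i j @[x --> F] --> (1%:M : 'M[R]_k) i j) ->
  \forall x \near F, forall c : 'rV[R]_k, c != 0 -> 0 < (c *m G x *m c^T) 0 0.
Proof.
move=> G1.
have H : \forall x \near F, forall i, forall j,
    `|G x i j - (1%:M : 'M[R]_k) i j| < k.+1%:R^-1.
  apply: filter_forall => i; apply: filter_forall => j.
  have /cvgr_dist_lt := G1 i j => /(_ k.+1%:R^-1).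
  rewrite invr_gt0 ltr0n => /(_ isT); apply: filterS => x.
  by rewrite distrC.
apply: filterS H => x Hx; exact: near1_posdef.
Qed.

End MatrixLimits.

(** * Frames and their row spaces *)

Section Rowspan.
Variables (R : realType) (n : nat).

Lemma rowspanE r (A : 'M[R]_(r, n)) : rowspan A = (linfun (mulmxr A) @: fullv)%VS.
Proof.
apply/eqP; rewrite eqEsubv; apply/andP; split.
  apply/subv_sumP => i _; rewrite -memvE rowE.
  have -> : delta_mx 0 i *m A = linfun (mulmxr A) (delta_mx 0 i : 'rV_r) by rewrite lfunE.
  by rewrite memv_img ?memvf.
apply/subvP => _ /memv_imgP[u _ ->]; rewrite lfunE /= mulmx_sum_row.
apply: memv_suml => i _; apply: memvZ.
by apply: (subvP (sumv_sup i isT (subvv _))); apply: memv_line.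
Qed.

Lemma rowspanP r (A : 'M[R]_(r, n)) x :
  reflect (exists c : 'rV[R]_r, x = c *m A) (x \in rowspan A).
Proof.
rewrite rowspanE; apply: (iffP memv_imgP) => [[u _ ->] | [c ->]].
  by exists u; rewrite lfunE.
by exists c; rewrite ?memvf ?lfunE.
Qed.

Lemma dim_rowspanP r (A : 'M[R]_(r, n)) :
  \dim (rowspan A) = r <-> (forall c : 'rV[R]_r, c *m A = 0 -> c = 0).
Proof.
have dr : \dim (fullv : {vspace 'rV[R]_r}) = r by rewrite dimvf /dim /= mul1n.
rewrite rowspanE; split=> [dA c cA0 | H].
  have := limg_ker_dim (linfun (mulmxr A)) (fullv : {vspace 'rV[R]_r}).
  rewrite dA dr => /(canRL (addnK _)); rewrite subnn => /eqP.
  rewrite dimv_eq0 => /capv0P; apply; first exact: memvf.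
  by rewrite memv_ker lfunE /= cA0.
rewrite limg_dim_eq //; apply/eqP/capv0P => c _.
by rewrite memv_ker lfunE /= => /eqP; apply: H.
Qed.

Lemma exists_rowspan (r : nat) (S : {vspace 'rV[R]_n}) : \dim S = r ->
  exists A : 'M[R]_(r, n), rowspan A = S.
Proof.
move=> <- {r}; exists (\matrix_(i < \dim S) (vbasis S)`_i).
rewrite -[RHS](span_basis (vbasisP S)) span_def (big_nth 0) big_mkord size_tuple.
by apply: eq_bigr => i _; rewrite rowK.
Qed.

(** With [D] a right inverse of [A0], the product [A *m D] is close to the identity, hence positive
    definite, and this excludes [c *m A = 0] for nonzero [c]. *)
Lemma near_dim_rowspan r (A0 : 'M[R]_(r, n)) : \dim (rowspan A0) = r ->
  \forall A \near A0, \dim (rowspan A) = r.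
Proof.
move=> /dim_rowspanP/inj_row_free/row_freeP[D AD].
have H : \forall A \near A0, forall c : 'rV[R]_r, c != 0 -> 0 < (c *m (A *m D) *m c^T) 0 0.
  apply: (@near_posdef R _ (nbhs A0) _ r (fun A => A *m D)) => i j; rewrite -AD; apply: cvg_mulmx => ? ?.
    exact: coord_continuous.
  exact: cvg_cst.
apply: filterS H => A HA; apply/dim_rowspanP => c cA0.
apply/eqP/negPn/negP => /HA.
by rewrite mulmxA cA0 !mul0mx mxE ltxx.
Qed.

End Rowspan.

(** * Lower semicontinuity of the indices in the frame *)

Section IndexSemicontinuity.
Variables (R : realType) (n : nat) (B : {symmetric 'rV[R]_n}).
Implicit Types (U W S : {vspace 'rV[R]_n}) (eps : R).

Lemma exists_orthonormal (V : vectType R) (D : {symmetric V}) eps (P : {vspace V}) k :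
  eps * eps = 1 -> sdefinite D eps P -> (k <= \dim P)%N ->
  exists x : nat -> V, forall i j, (i < k)%N -> (j < k)%N ->
    x i \in P /\ D (x i) (x j) = eps *+ (i == j).
Proof.
move=> ee; elim: k P => [|k IHk] P Pd kP; first by exists (fun=> 0).
have [e eP eE] := has_sdefinite_unit ee (has_sdefinite_dim_pos Pd (leq_ltn_trans (leq0n k) kP)).
have [||x xP] := IHk (P :&: orthov D <[e]>)%VS.
- exact: sdefiniteS (capvSl _ _) Pd.
- by rewrite -ltnS (leq_trans kP) ?dim_cap_orthov_line.
exists (fun i => if i is i'.+1 then x i' else e).
have xe i : (i < k)%N -> x i \in P /\ D (x i) e = 0.
  move=> ik; have [/memv_capP[xiP]] := xP i i ik ik.
  by rewrite mem_orthov1 => /eqP xie _.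
move=> [|i] [|j] //=; rewrite ?ltnS => ik jk.
- by split=> //; case: (xe j jk) => _ ej; rewrite symformC ej.
- by case: (xe i ik).
- by split; [case: (xe i ik) | case: (xP i j ik jk)].
Qed.

Lemma matrix_formE (p : 'End('rV[R]_n)) (v w : 'rV[R]_n) :
  (v *m (\matrix_(i, j) B (p (delta_mx 0 i)) (p (delta_mx 0 j))) *m w^T) 0 0 = B (p v) (p w).
Proof.
have pE u : p u = \sum_i u 0 i *: p (delta_mx 0 i).
  rewrite {1}(row_sum_delta u) linear_sum; apply: eq_bigr => i _.
  by rewrite linearZ.
rewrite [in RHS](pE w) linear_sumr mxE; apply: eq_bigr => j _.
transitivity (w 0 j * B (p v) (p (delta_mx 0 j))); last by symmetry; apply: formZR.
rewrite !mxE mulrC; congr (_ * _).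
rewrite symformC (pE v) linear_sumr; apply: eq_bigr => i _.
transitivity (v 0 i * B (p (delta_mx 0 j)) (p (delta_mx 0 i))); last by symmetry; apply: formZR.
by rewrite mxE symformC.
Qed.

Lemma near_has_sdefinite U W eps (r k : nat) (A0 : 'M[R]_(r, n)) : orth_decomp B U W ->
  eps * eps = 1 -> has_sdefinite B eps (proj_to U W (rowspan A0)) k ->
  \forall A \near A0, has_sdefinite B eps (proj_to U W (rowspan A)) k.
Proof.
move=> UW ee [P [PS Pd dP]].
have [x xP] := exists_orthonormal ee Pd (eq_leq (esym dP)).
set pU := daddv_pi U W.
have lift (i : 'I_k) : exists c : 'rV[R]_r, pU (c *m A0) = x i.
  have [xiP _] := xP i i (ltn_ord i) (ltn_ord i).
  have /(proj_toP UW)[s /rowspanP[c ->] ->] := subvP PS _ xiP.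
  by exists c.
have [c cE] := choice lift.
pose C := \matrix_i c i; pose M := \matrix_(i, j) B (pU (delta_mx 0 i)) (pU (delta_mx 0 j)).
(* [eps] times the Gram matrix of the vectors [pU (c i *m A)], with the coefficients [c i] held
   fixed. It is the identity at [A0], so it stays positive definite nearby. *)
pose G (A : 'M[R]_(r, n)) := eps *: (C *m A *m M *m (C *m A)^T).
have GE A (v w : 'rV[R]_k) :
    (v *m G A *m w^T) 0 0 = eps * B (pU (v *m C *m A)) (pU (w *m C *m A)).
  by rewrite /G -matrix_formE -/M -scalemxAr -scalemxAl mxE !trmx_mul !mulmxA.
have CE i : delta_mx 0 i *m C *m A0 = c i *m A0 by rewrite -rowE rowK.
have G0 : G A0 = 1%:M.
  apply/matrixP => i j.
  have -> : G A0 i j = eps * B (pU (c i *m A0)) (pU (c j *m A0)).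
    by rewrite -!CE -GE trmx_delta -rowE -colE !mxE.
  rewrite !cE; have [_ ->] := xP i j (ltn_ord i) (ltn_ord j).
  by rewrite mxE mulrnAr ee.
have H : \forall A \near A0, forall v : 'rV[R]_k, v != 0 -> 0 < (v *m G A *m v^T) 0 0.
  apply: (@near_posdef R _ (nbhs A0) _ k G) => i j; rewrite -G0 /G mxE.
  under eq_cvg do rewrite mxE.
  apply: cvgMl_tmp; apply: cvg_mulmx => {i j} i j.
    apply: cvg_mulmx => {i j} i j; last exact: cvg_cst.
    by apply: cvg_mulmx => {i j} i j; [exact: cvg_cst | exact: coord_continuous].
  rewrite mxE; under eq_cvg do rewrite mxE.
  by apply: cvg_mulmx => {i j} i j; [exact: cvg_cst | exact: coord_continuous].
apply: filterS H => A HA.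
pose f := (pU \o linfun (mulmxr (C *m A)))%VF : 'Hom('rV[R]_k, 'rV[R]_n).
have fE v : f v = pU (v *m C *m A) by rewrite comp_lfunE lfunE /= mulmxA.
exists (f @: fullv)%VS; split.
- apply/subvP => _ /memv_imgP[v _ ->]; rewrite fE (mem_proj_to UW) //.
  by apply/rowspanP; exists (v *m C).
- move=> _ /memv_imgP[v _ ->] fv0; rewrite fE -GE; apply: HA.
  by apply: contraNneq fv0 => ->; rewrite linear0.
- rewrite limg_dim_eq; first by rewrite dimvf /dim /= mul1n.
  apply/eqP/capv0P => v _; rewrite memv_ker => /eqP fv0.
  apply/eqP/negPn/negP => /HA.
  by rewrite GE -fE fv0 linear0l mulr0 ltxx.
Qed.

Lemma open_index U W (r k l : nat) : orth_decomp B U W ->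
  open_in_Gr r [set S | (k <= pos_index B (proj_to U W S))%N /\
                        (l <= neg_index B (proj_to U W S))%N].
Proof.
move=> UW; rewrite /open_in_Gr openE => A0 [dA0 [/leq_pos_index kA0 /leq_neg_index lA0]].
have Hd := near_dim_rowspan dA0.
have Hk := near_has_sdefinite UW (mulr1 1) kA0.
have eN1 : (-1 : R) * -1 = 1 by rewrite mulrNN mulr1.
have Hl := near_has_sdefinite UW eN1 lA0.
apply: filterS3 Hd Hk Hl => A dA kA lA /=.
by split=> //; split; [apply/leq_pos_index | apply/leq_neg_index].
Qed.

(** The rotated frame depends continuously on [c] and is the original frame at [c = 1]. *)
Lemma open_in_Gr_scaling (r : nat) S (N M : 'rV[R]_n) (Om : set {vspace 'rV[R]_n}) :
  open_in_Gr r Om -> \dim S = r -> Om S ->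
  exists2 c : R, 1 < c & forall g : 'End('rV[R]_n),
    (forall z, g z = z + ((c - 1) * B z M) *: N + ((c^-1 - 1) * B z N) *: M) ->
    Om (g @: S)%VS.
Proof.
move=> openOm dS OmS; have [A0 A0S] := exists_rowspan dS.
pose form_col (z : 'rV[R]_n) : 'M[R]_(r, 1) := \col_i B (row i A0) z.
pose G (c : R) := A0 + (c - 1) *: (form_col M *m N) + (c^-1 - 1) *: (form_col N *m M).
have OmA0 : nbhs A0 [set A : 'M[R]_(r, n) | \dim (rowspan A) = r /\ Om (rowspan A)].
  by apply: open_nbhs_nbhs; split=> //=; rewrite A0S.
have G1 i j : G c i j @[c --> (1 : R)] --> A0 i j.
  have GE c : G c i j = A0 i j + (c - 1) * (form_col M *m N) i j +
     (c^-1 - 1) * (form_col N *m M) i j by rewrite !mxE.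
  under eq_cvg do rewrite GE.
  have lim : A0 i j + (1 - 1) * (form_col M *m N) i j +
      (1^-1 - 1) * (form_col N *m M) i j = A0 i j.
    by rewrite invr1 subrr !mul0r !addr0.
  rewrite -[in X in nbhs X]lim.
  apply: cvgD; first apply: cvgD.
  - exact: cvg_cst.
  - by apply: cvgMr_tmp; apply: cvgB; [exact: cvg_id | exact: cvg_cst].
  - apply: cvgMr_tmp; apply: cvgB; last exact: cvg_cst.
    by apply: cvgV; [exact: oner_neq0 | exact: cvg_id].
have /nbhs_ballP[e /= e0 eG] : \forall c \near (1 : R),
    \dim (rowspan (G c)) = r /\ Om (rowspan (G c)) by exact: near_mx G1 OmA0.
exists (1 + e / 2); first by rewrite ltrDl divr_gt0.
move=> g gE; have [|_] := eG (1 + e / 2).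
  rewrite /ball /= opprD addrA subrr add0r normrN gtr0_norm ?divr_gt0 //.
  by rewrite ltr_pdivrMr // ltr_pMr // ltr1n.
congr Om; rewrite -A0S /rowspan limg_sum; apply: eq_bigr => i _.
rewrite limg_line gE; congr <[_]>%VS; apply/rowP => j; rewrite !mxE.
by rewrite !big_ord1 !mxE !mulrA.
Qed.

End IndexSemicontinuity.

(** * Open orbits *)

Section OpenOrbits.
Variables (R : realType) (n : nat) (B : {symmetric 'rV[R]_n}).
Implicit Types (U W S : {vspace 'rV[R]_n}) (Om : set {vspace 'rV[R]_n}).

Lemma has_signature_dim (V : vectType R) (D : {symmetric V}) (X : {vspace V}) a b :
  has_signature D X a b -> \dim X = (a + b)%N.
Proof.
move=> /signature_decomposition[P [Q [Pd Qd _ <- [<- <-]]]].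
by rewrite dimv_disjoint_sum ?(sdefinite_cap Pd Qd).
Qed.

Lemma pos_index_proj_leq U W S a b c d : orth_decomp B U W -> totally_isotropic B S ->
  has_signature B U a b -> has_signature B W c d ->
  (pos_index B (proj_to U W S) <= minn a d)%N.
Proof.
move=> UW Siso [_ <- _] [_ _ <-]; rewrite leq_min; apply/andP; split.
  apply/leq_pos_index; apply: has_sdefiniteS (capvSr (S + W) U) _.
  exact/leq_pos_index.
apply/leq_neg_index; apply: has_sdefiniteS (capvSr (S + U) W) _.
apply: (has_sdefinite_proj_swap UW Siso); exact/leq_pos_index.
Qed.

Lemma index_growth_in_open U W S Om (r : nat) a b c d : orth_decomp B U W ->
  radical B fullv = 0%VS -> has_signature B U a b -> has_signature B W c d ->
  isoGr B r S -> open_in_Gr r Om -> Om S ->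
  (pos_index B (proj_to U W S) + neg_index B (proj_to U W S) < r)%N ->
  (pos_index B (proj_to U W S) < minn a d)%N ->
  exists S', [/\ isoGr B r S', Om S' &
                 (pos_index B (proj_to U W S) < pos_index B (proj_to U W S'))%N].
Proof.
move=> UW V0 [U0 Ua _] [W0 _ Wd] [dS Siso] openOm OmS; rewrite -{1}dS => hr hk.
have Up : has_sdefinite B 1 U a by apply/leq_pos_index; rewrite Ua.
have Wq : has_sdefinite B (-1) W d by apply/leq_neg_index; rewrite Wd.
have [N [M [NN MM NM grow]]] := isotropic_perturbation UW U0 W0 Up Wq Siso hr hk.
have [t t1 OmG] := open_in_Gr_scaling B N M openOm dS OmS.
have t0 : t != 0 by rewrite gt_eqF // (lt_trans ltr01).
have [g [gI gE]] := scaling_isometry V0 (memvf N) (memvf M) NN MM NM t0.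
exists (g @: S)%VS; split; [|exact: OmG|].
  apply: (isoGr_isometry _ _ (conj dS Siso)) => [x y | x gx0].
    by apply: gI.2; apply: memvf.
  exact: isometry_of_eq0 V0 gI (memvf x) gx0.
by apply/leq_pos_index; apply: grow gE.
Qed.

Lemma open_generic_set U W (p q p1 q1 p2 q2 r k l : nat) : orth_decomp B U W ->
  has_signature B fullv p q -> has_signature B U p1 q1 -> has_signature B W p2 q2 ->
  (k <= minn p1 q2)%N -> (l <= minn q1 p2)%N -> (k + l <= r)%N -> (r <= minn p q)%N ->
  [\/ k + l = r, k + l = \dim W | k + l = \dim U]%N ->
  open_orbit B U W r (generic_set B U W r k l).
Proof.
move=> UW hV hU hW hk hl hkl hr hdim; split.
  have [S SG [kS lS]] := exists_isotropic UW hV hU hW hk hl hkl hr.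
  exists S => //; case: hU hW => U0 _ _ [W0 _ _].
  apply: (generic_set_orbit UW U0 W0 hdim).
  by split=> //; [apply/leq_pos_index | apply/leq_neg_index].
exists [set S | (k <= pos_index B (proj_to U W S))%N /\
                (l <= neg_index B (proj_to U W S))%N]; first exact: open_index.
by apply/seteqP; split=> S [] // SG [].
Qed.

Lemma open_orbit_generic U W Om (p q p1 q1 p2 q2 r : nat) : orth_decomp B U W ->
  has_signature B fullv p q -> has_signature B U p1 q1 -> has_signature B W p2 q2 ->
  (forall k l, (k <= minn p1 q2)%N -> (l <= minn q1 p2)%N ->
    (k + l = minn r (minn p1 q2 + minn q1 p2))%N ->
    [\/ k + l = r, k + l = \dim W | k + l = \dim U]%N) ->
  open_orbit B U W r Om ->
  exists k l, [/\ (k <= minn p1 q2)%N, (l <= minn q1 p2)%N,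
    (k + l = minn r (minn p1 q2 + minn q1 p2))%N & Om = generic_set B U W r k l].
Proof.
move=> UW [V0 _ _] hU hW hdim [[S SG OmE] [Om' openOm' OmE']].
have WU := orth_decomp_sym UW; have [dS Siso] := SG.
pose k := pos_index B (proj_to U W S); pose l := neg_index B (proj_to U W S).
have hk : (k <= minn p1 q2)%N by apply: pos_index_proj_leq UW Siso hU hW.
have lE : pos_index B (proj_to W U S) = l by apply: pos_index_proj_swap.
have kE : neg_index B (proj_to W U S) = k by rewrite -pos_index_proj_swap.
have hl : (l <= minn q1 p2)%N.
  by rewrite minnC -lE; apply: pos_index_proj_leq WU Siso hW hU.
have hkl : (k + l <= r)%N.
  rewrite -dS -(dim_proj_to UW S); apply: leq_trans (leq_addr _ _).
  exact: index_sum_leq.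
have idI : isometry_prod B U W \1%VF by split; apply: isometry_of_id.
have OmS : Om S by rewrite OmE; exists \1%VF; rewrite ?lim1g.
have Om'S : Om' S by move: OmS; rewrite OmE' => -[].
(* Near [S] every isotropic subspace lies in the orbit of [S], so neither index can grow there. *)
have stable S' : isoGr B r S' -> Om' S' ->
    pos_index B (proj_to U W S') = k /\ neg_index B (proj_to U W S') = l.
  move=> S'G Om'S'; have : Om S' by rewrite OmE'.
  by rewrite OmE => -[g gI <-]; apply: isometry_prod_index.
have klE : (k + l = minn r (minn p1 q2 + minn q1 p2))%N.
  apply/eqP; rewrite eqn_leq leq_min hkl leq_add //= leqNgt; apply/negP => lt.
  have hr : (k + l < r)%N by move: lt; rewrite leq_min => /andP[].
  have [hk' | hk'] := ltnP k (minn p1 q2).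
    have [S' [S'G Om'S' grow]] := index_growth_in_open UW V0 hU hW SG openOm' Om'S hr hk'.
    by have [kS' _] := stable S' S'G Om'S'; move: grow; rewrite kS' ltnn.
  have hl' : (l < minn p2 q1)%N by move: lt; rewrite leq_min (minnC p2); lia.
  have hr' : (pos_index B (proj_to W U S) + neg_index B (proj_to W U S) < r)%N.
    by rewrite lE kE addnC.
  rewrite -lE in hl'.
  have [S' [S'G Om'S' grow]] := index_growth_in_open WU V0 hW hU SG openOm' Om'S hr' hl'.
  have [_ lS'] := stable S' S'G Om'S'.
  by move: grow; rewrite lE (pos_index_proj_swap UW S'G.2) lS' ltnn.
exists k, l; split=> //; rewrite OmE; apply/esym.
case: hU hW => U0 _ _ [W0 _ _].
by apply: (generic_set_orbit UW U0 W0 (hdim k l hk hl klE)).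
Qed.

End OpenOrbits.

Theorem corollary5p4 (R : realType) (p q p1 q1 r : nat)
  (B : {symmetric 'rV[R]_(p + q)}) (U W : {vspace 'rV[R]_(p + q)})
  (hp1 : (0 < p1 < p)%N) (hq1 : (0 < q1 < q)%N) (hr : (r <= minn p q)%N)
  (hB : has_signature B fullv p q)
  (hUW : (U + W)%VS = fullv) (hUW0 : (U :&: W)%VS = 0%VS)
  (hperp : (U <= orthov B W)%VS)
  (hU : has_signature B U p1 q1)
  (hW : has_signature B W (p - p1) (q - q1)) :
  ((r < minn p1 (q - q1) + minn q1 (p - p1))%N ->
     (forall Om : set {vspace 'rV[R]_(p + q)},
        open_orbit B U W r Om <->
        exists bU bW : nat,
          [/\ (bU + bW)%N = r, (bU <= minn p1 (q - q1))%N,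
              (bW <= minn q1 (p - p1))%N & Om = O_ B U W r 0 0 0 bU bW]) /\
     ((0 < r)%N ->
        exists Om1 Om2 : set {vspace 'rV[R]_(p + q)},
          [/\ open_orbit B U W r Om1, open_orbit B U W r Om2 & Om1 <> Om2]))
  /\
  ((minn p1 (q - q1) + minn q1 (p - p1) <= r)%N ->
     let bU := minn p1 (q - q1) in
     let bW := minn q1 (p - p1) in
     forall Om : set {vspace 'rV[R]_(p + q)},
       open_orbit B U W r Om <->
       Om = if (\dim W < \dim U)%N
            then O_ B U W r (r - bU - bW) 0 0 bU bW
            else O_ B U W r 0 (r - bU - bW) 0 bU bW).
Proof.
have UW : orth_decomp B U W by split.
have dU := has_signature_dim hU; have dW := has_signature_dim hW.
(* If [k + l] is not [r], then [k] and [l] are the two minima and their sum is below [r]. Sums equal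
   to [p] or [q] are ruled out by [hr], which leaves the dimensions of [U] and [W]. *)
have hdim k l : (k <= minn p1 (q - q1))%N -> (l <= minn q1 (p - p1))%N ->
    (k + l = minn r (minn p1 (q - q1) + minn q1 (p - p1)))%N ->
    [\/ k + l = r, k + l = \dim W | k + l = \dim U]%N.
  move=> hk hl hkl.
  have [E | NE] := eqVneq (k + l)%N r; first by constructor 1.
  have [E | NE'] := eqVneq (k + l)%N (\dim W); first by constructor 2.
  by constructor 3; rewrite dU; rewrite dW in NE'; lia.
have generic_open k l : (k <= minn p1 (q - q1))%N -> (l <= minn q1 (p - p1))%N ->
    (k + l = minn r (minn p1 (q - q1) + minn q1 (p - p1)))%N ->
    open_orbit B U W r (generic_set B U W r k l).
  move=> hk hl hkl; apply: (open_generic_set UW hB hU hW) => //; last exact: hdim.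
  by rewrite hkl geq_minl.
have open_generic Om := open_orbit_generic UW hB hU hW hdim (Om := Om).
split=> [hlt | hge].
  have Er : minn r (minn p1 (q - q1) + minn q1 (p - p1)) = r by apply/minn_idPl/ltnW.
  rewrite Er in generic_open open_generic.
  split=> [Om | r0].
    split=> [/open_generic[k [l [hk hl hkl ->]]] | [k [l [hkl hk hl ->]]]].
      by exists k, l; split=> //; apply: generic_set_O_full.
    by rewrite -generic_set_O_full //; apply: generic_open.
  (* For [r = 0] there is a single point. For [0 < r] this [k] is positive and [l] is strictly below
     its bound, so [(k, l)] and [(k.-1, l.+1)] are both admissible; the value of [b_U] separates
     their orbits. *)
  pose k := minn r (minn p1 (q - q1)); pose l := (r - k)%N.
  have k0 : (0 < k)%N by rewrite /k; lia.
  have hk : (k <= minn p1 (q - q1))%N by rewrite /k; lia.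
  have hl : (l.+1 <= minn q1 (p - p1))%N by rewrite /l /k; lia.
  have hkl : (k + l = r)%N by rewrite /l /k; lia.
  have hkl' : (k.-1 + l.+1 = r)%N by lia.
  exists (generic_set B U W r k l), (generic_set B U W r k.-1 l.+1); split.
  - by apply: generic_open => //; apply: ltnW.
  - by apply: generic_open => //; apply: leq_trans hk; apply: leq_pred.
  have [|S SG [kS lS]] := exists_isotropic UW hB hU hW hk (ltnW hl) _ hr.
    by rewrite hkl.
  have SE : generic_set B U W r k l S.
    by split=> //; [apply/leq_pos_index | apply/leq_neg_index].
  move=> E; move: (SE); rewrite E => SE'.
  have [_ _ _ kE _] := generic_set_full UW hkl SE.
  have [_ _ _ k'E _] := generic_set_full UW hkl' SE'.
  by move: k'E; rewrite kE; lia.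
move=> bU bW Om.
have Em : minn r (minn p1 (q - q1) + minn q1 (p - p1)) = (bU + bW)%N by apply/minn_idPr.
rewrite Em in generic_open open_generic.
have <- : generic_set B U W r bU bW =
    (if (\dim W < \dim U)%N
     then O_ B U W r (r - bU - bW) 0 0 bU bW
     else O_ B U W r 0 (r - bU - bW) 0 bU bW).
  (* If the sum is [r], both branches are the same orbit with trivial intersections. Otherwise the
     sum is the smaller of [\dim U] and [\dim W], which selects the branch. *)
  have [E | NE] := eqVneq (bU + bW)%N r.
    have -> : (r - bU - bW = 0)%N by lia.
    by rewrite if_same; apply: generic_set_O_full.
  case: ifP => hd.
    by apply: generic_set_O_dimW => //; rewrite dU dW in hd *; rewrite /bU /bW in hge NE *; lia.
  by apply: generic_set_O_dimU => //; rewrite dU dW in hd *; rewrite /bU /bW in hge NE *; lia.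
split=> [/open_generic[k [l [hk hl hkl ->]]] | ->]; last exact: generic_open.
by congr generic_set; rewrite /bU /bW in hkl *; lia.
Qed.
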